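(* Let $n\geqslant1$. For any strict partition $\lambda\in\mathcal{D}_n$ the type $B$ double Schubert polynomial $\mathfrak{B}_\lambda(X,Y)=\mathfrak{B}_{w_\lambda}(X,Y)$ is equal to $$(-1)^{e(\lambda)+|\lambda'|}\sum_{\alpha}\widetilde P_\alpha(X)\sum_{\beta}(-1)^{e(\alpha,\beta)+|\beta|}\,\widetilde P_{(\alpha\cup\beta)'}(Y)\,\det\bigl(e_{\beta_i-\lambda'_j}(Y_{n-\lambda'_j})\bigr)_{1\leqslant i,j\leqslant\ell(\lambda')},$$ where the first sum is over all $\alpha\in\mathcal{D}_n$ and the second over $\beta\in\mathcal{D}_n$ with $\beta\supset\lambda'$, $\ell(\beta)=\ell(\lambda')$ and $\alpha\cap\beta=\emptyset$.
   Context: Partitions. $|\lambda|$ is the sum of the parts, $\ell(\lambda)$ the number of nonzero parts, $\lambda_r=0$ for $r>\ell(\lambda)$. $\mu\subset\lambda$ means $\mu_i\leqslant\lambda_i$ for all $i$; $\cup,\cap$ are taken on sets of parts. $\mathcal{D}_n$ is the set of strict partitions (distinct nonzero parts, possibly none) with all parts at most $n$. $\lambda'$ is the strict partition whose parts are the complement of the parts of $\lambda$ in $\{1,\ldots,n\}$. $e(\lambda)=|\lambda|-\ell(\lambda)(\ell(\lambda)+1)/2$. For $\alpha,\beta\in\mathcal{D}_n$ with $\alpha\cap\beta=\emptyset$: $m_i(\alpha,\beta)=\#\{j\mid\alpha_i>\beta_j>\alpha_{i+1}\}$, $e(\alpha,\beta)=\sum_{i\geqslant1}i\,m_i(\alpha,\beta)$.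 Variables and polynomials. $X_k=(x_1,\ldots,x_k)$, $Y_k=(y_1,\ldots,y_k)$, $X=X_n$, $Y=Y_n$; $e_i$ is the elementary symmetric polynomial ($e_0=1$, $e_i=0$ for $i<0$). $\widetilde Q_i(X)=e_i(X)$, $\widetilde Q_{i,j}=\widetilde Q_i\widetilde Q_j+2\sum_{k=1}^j(-1)^k\widetilde Q_{i+k}\widetilde Q_{j-k}$, and for $\lambda=(\lambda_1\geqslant\cdots\geqslant\lambda_r\geqslant0)$ with $r$ even (put $\lambda_r=0$ if necessary), $\widetilde Q_\lambda=\mathrm{Pfaffian}[\widetilde Q_{\lambda_i,\lambda_j}]_{1\leqslant i<j\leqslant r}$. $\widetilde P_\lambda(X)=2^{-\ell(\lambda)}\widetilde Q_\lambda(X)$; $\widetilde P_n(X,Y)=\sum_{\lambda\in\mathcal{D}_n}\widetilde P_\lambda(X)\widetilde P_{\lambda'}(Y)$; $\Delta(X,Y)=\prod_{i+j\leqslant n}(x_i-y_j)$. Weyl group and type $B$ divided differences. $W_n$ is the hyperoctahedral group of signed permutations $w=(w_1,\ldots,w_n)$ (a bar denotes a negative entry), generated by simple transpositions $s_i$ ($1\leqslant i\leqslant n-1$) and $s_0$; right multiplication by $s_i$ interchanges the entries in positions $i,i+1$, and $(u_1,\ldots,u_n)s_0=(\overline{u}_1,u_2,\ldots,u_n)$; $w_0=(\overline1,\ldots,\overline n)$. For $\lambda\in\mathcal{D}_n$ with $\ell=\ell(\lambda)$, $k=n-\ell$: $w_\lambda=(\overline{\lambda}_1,\ldots,\overline{\lambda}_\ell,\lambda'_k,\ldots,\lambda'_1)$.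 $W_n$ acts on $\mathbb{Z}[1/2][Y][X]$: $s_i$ interchanges $x_i,x_{i+1}$, and $s_0$ sends $x_1$ to $-x_1$. $\partial_i(f)=(f-s_if)/(x_i-x_{i+1})$ for $1\leqslant i\leqslant n-1$, $\partial_0(f)=(f-s_0f)/x_1$; $\partial'_i=-\partial_i$ for $1\leqslant i\leqslant n-1$, $\partial'_0=\partial_0$; $\partial'_w=\partial'_{a_1}\circ\cdots\circ\partial'_{a_r}$ for a reduced word $w=s_{a_1}\cdots s_{a_r}$. The type $B$ double Schubert polynomials are $$\mathfrak{B}_w(X,Y)=(-1)^{n(n-1)/2}\,\partial'_{w^{-1}w_0}\bigl(\Delta(X,Y)\widetilde P_n(X,Y)\bigr),\qquad w\in W_n.$$ *)

(* Defs.v *)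
From HB Require Import structures.
From mathcomp Require Import all_boot all_order all_algebra all_fingroup.
From mathcomp Require Import mpoly.

Set Implicit Arguments.
Unset Strict Implicit.
Unset Printing Implicit Defensive.

Import GRing.Theory Num.Theory.
Local Open Scope ring_scope.

(** * The coefficient ring Z[1/2], as a subring of the rationals *)

Definition dyadic : {pred rat} := fun x => (2%N).-nat `|denq x|%N.

Fact dyadicP (x : rat) :
  reflect (exists (k : nat) (m : int), x * 2%:R ^+ k = m%:~R) (x \in dyadic).
Proof.
apply: (iffP idP) => [/p_natP [k dx]|[k [m xk]]].
  exists k, (numq x).
  have dE : denq x = (2 ^ k)%N :> int.
    by rewrite -dx gez0_abs // ltW // denq_gt0.
  rewrite -[x in x * _]divq_num_den dE -pmulrn natrX mulfVK //.
  by rewrite expf_neq0.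
have : (denq x %| 2%:R ^+ k)%Z.
  rewrite -(@Gauss_dvdzr _ (numq x)); last first.
    by rewrite /coprimez /gcdz gcdnC; have := coprime_num_den x; rewrite /coprime => /eqP->.
  apply/dvdzP; exists m.
  apply: (@intr_inj rat); rewrite !rmorphM /= -xk rmorphXn /=.
  by rewrite -{2}[x]divq_num_den mulrAC mulfVK // intr_eq0 denq_neq0.
rewrite dvdzE abszX => dv.
by apply: (pnat_dvd dv); rewrite pnatX.
Qed.

Fact dyadic_subring : subring_closed dyadic.
Proof.
split=> [|x y|x y].
- by apply/dyadicP; exists 0%N, 1; rewrite mulr1.
- move=> /dyadicP[k [a xa]] /dyadicP[l [b yb]]; apply/dyadicP.
  exists (k + l)%N, (a * 2%:R ^+ l - b * 2%:R ^+ k).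
  rewrite rmorphB !rmorphM !rmorphXn /= -xa -yb exprD mulrBl.
  by congr (_ - _); rewrite -!mulrA // [_ ^+ l * _]mulrC.
- move=> /dyadicP[k [a xa]] /dyadicP[l [b yb]]; apply/dyadicP.
  by exists (k + l)%N, (a * b); rewrite rmorphM /= -xa -yb exprD mulrACA.
Qed.

HB.instance Definition _ := GRing.isSubringClosed.Build rat dyadic dyadic_subring.

Record Zhalf := MkZhalf { Zhalf_val :> rat; _ : Zhalf_val \in dyadic }.

HB.instance Definition _ := [isSub for Zhalf_val].
HB.instance Definition _ := [Choice of Zhalf by <:].
HB.instance Definition _ := [SubChoice_isSubComNzRing of Zhalf by <:].

Definition Zhalf_unit : pred Zhalf :=
  fun x => (val x != 0) && ((val x)^-1 \in dyadic).
Definition Zhalf_inv (x : Zhalf) : Zhalf :=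
  if Zhalf_unit x then insubd x (val x)^-1 else x.

Fact Zhalf_mulVx : {in Zhalf_unit, left_inverse 1 Zhalf_inv *%R}.
Proof.
move=> x Ux; have Ux' : Zhalf_unit x := Ux.
case/andP: (Ux') => x0 dx; apply: val_inj; rewrite /Zhalf_inv Ux'.
rewrite rmorphM rmorph1 /=.
by have /= -> := insubdK x dx; rewrite mulVf.
Qed.

Fact Zhalf_unitP (x y : Zhalf) : y * x = 1 -> Zhalf_unit x.
Proof.
move=> /(congr1 val); rewrite rmorphM rmorph1 /= => yx1.
have x0 : Zhalf_val x != 0.
  by apply/eqP=> x0; move/eqP: yx1; rewrite x0 mulr0 eq_sym oner_eq0.
rewrite /Zhalf_unit x0 /=; suff -> : (Zhalf_val x)^-1 = Zhalf_val y by case: (y).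
by rewrite -[LHS]mul1r -yx1 mulfK.
Qed.

Fact Zhalf_inv_out : {in [predC Zhalf_unit], Zhalf_inv =1 id}.
Proof. by move=> x Ux; rewrite /Zhalf_inv (negbTE (Ux : ~~ Zhalf_unit x)). Qed.

HB.instance Definition _ :=
  GRing.ComNzRing_hasMulInverse.Build Zhalf Zhalf_mulVx Zhalf_unitP Zhalf_inv_out.

Fact Zhalf_idomain (x y : Zhalf) : x * y = 0 -> (x == 0) || (y == 0).
Proof.
move=> /(congr1 val); rewrite rmorphM rmorph0 => /eqP.
by rewrite mulf_eq0 => /orP[] xy0; apply/orP; [left|right]; apply/eqP/val_inj/eqP.
Qed.

HB.instance Definition _ := GRing.ComUnitRing_isIntegral.Build Zhalf Zhalf_idomain.

(** * Strict partitions

    A strict partition with parts at most [n] is encoded by the set of its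
    parts, where [i : 'I_n] stands for the part [i.+1]. *)

Notation strict_partition n := {set 'I_n}.

Section StrictPartitions.
Variable n : nat.
Implicit Types lambda mu alpha beta : strict_partition n.

Definition parts lambda : seq nat := rev [seq (val i).+1 | i <- enum lambda].
Definition len lambda : nat := size (parts lambda).
Definition weight lambda : nat := sumn (parts lambda).
(* [part lambda r] is the part of index [r >= 1], and 0 for [r > len lambda]. *)
Definition part lambda (r : nat) : nat := nth 0%N (parts lambda) r.-1.
Definition compl lambda : strict_partition n := ~: lambda.

(* Containment of Young diagrams, not of sets of parts. *)
Definition contained mu lambda : bool :=
  [forall r : 'I_n, part mu r.+1 <= part lambda r.+1]%N.

(* No truncation: distinct positive parts have sum at least 1 + ... + len lambda. *)
Definition excess lambda : nat :=
  (weight lambda - (len lambda * (len lambda).+1)./2)%N.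

Definition interlace alpha beta (i : nat) : nat :=
  count (fun b => part alpha i.+1 < b < part alpha i)%N (parts beta).
Definition excess2 alpha beta : nat :=
  (\sum_(1 <= i < (len alpha).+1) i * interlace alpha beta i)%N.

End StrictPartitions.

(** * The polynomials of Pragacz and Ratajski *)

Section QtildePolynomials.
Variables (A : comUnitRingType) (v : seq A).

Definition elemsym (i : int) : A :=
  if i is Posz k then (mesym (size v) A k).@[fun j => v`_j] else 0.

Definition Qtilde2 (i j : nat) : A :=
  elemsym i * elemsym j +
  2%:R * \sum_(1 <= k < j.+1) (-1) ^+ k * (elemsym (i + k)%N * elemsym (j - k)%N).

End QtildePolynomials.

Section Pfaffian.
Variables (A : comUnitRingType) (m : nat).

Fact even_ord_subproof (i : 'I_m) : (i.*2 < m.*2)%N.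
Proof. by rewrite ltn_double. Qed.
Fact odd_ord_subproof (i : 'I_m) : (i.*2.+1 < m.*2)%N.
Proof. by rewrite ltn_Sdouble. Qed.
Definition even_ord (i : 'I_m) : 'I_m.*2 := Ordinal (even_ord_subproof i).
Definition odd_ord (i : 'I_m) : 'I_m.*2 := Ordinal (odd_ord_subproof i).

(* The permutations encoding the perfect matchings
   {s 0, s 1}, {s 2, s 3}, ... with s 0 < s 1, s 2 < s 3, ... and
   s 0 < s 2 < ... *)
Definition matching (s : 'S_m.*2) : bool :=
  [forall i, s (even_ord i) < s (odd_ord i)]%N &&
  [forall i : 'I_m, forall j : 'I_m, (i < j) ==> (s (even_ord i) < s (even_ord j))]%N.

(* Only the entries above the diagonal are used. *)
Definition pfaffian (M : 'M[A]_m.*2) : A :=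
  \sum_(s : 'S_m.*2 | matching s)
    (-1) ^+ s * \prod_(i < m) M (s (even_ord i)) (s (odd_ord i)).

End Pfaffian.

Section PtildePolynomials.
Variables (A : comUnitRingType) (n : nat).
Implicit Types (v : seq A) (lambda : strict_partition n).

(* The order [(uphalf (len lambda)).*2] is [len lambda], plus 1 when this is
   odd; in the latter case the last index refers to a zero part. *)
Definition Qtilde lambda v : A :=
  pfaffian (\matrix_(i < (uphalf (len lambda)).*2,
                     j < (uphalf (len lambda)).*2)
              Qtilde2 v (part lambda i.+1) (part lambda j.+1)).

Definition Ptilde lambda v : A := 2%:R ^- len lambda * Qtilde lambda v.

End PtildePolynomials.

(** * The hyperoctahedral group

    The pair [(p, e)] is the signed permutation [w] whose entry [w_i] has
    absolute value [p i] and is negative if and only if [e i].  The product is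
    composition of signed permutations, [(w * u)_i = w(u_i)], where
    [w(-j) = - w(j)]; recall that permutations compose from left to right in
    [{perm T}]. *)

Definition signed_perm (n : nat) : Type := ('S_n * {ffun 'I_n -> bool})%type.
HB.instance Definition _ n := Finite.copy (signed_perm n) ('S_n * {ffun 'I_n -> bool})%type.

Section SignedPerm.
Variable n : nat.
Local Notation W := (signed_perm n).

Definition signed_mul (w u : W) : W :=
  ((u.1 * w.1)%g, [ffun i => u.2 i (+) w.2 (u.1 i)]).
Definition signed_one : W := (1%g, [ffun => false]).
Definition signed_inv (w : W) : W :=
  ((w.1^-1)%g, [ffun i => w.2 ((w.1^-1)%g i)]).

Fact signed_mulA : associative signed_mul.
Proof.
move=> w u t; congr pair => /=; first by rewrite mulgA.
by apply/ffunP=> i; rewrite !ffunE permM addbA.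
Qed.
Fact signed_mul1 : left_id signed_one signed_mul.
Proof.
case=> p e; congr pair => /=; first by rewrite mulg1.
by apply/ffunP=> i; rewrite !ffunE addbF.
Qed.
Fact signed_mulV : left_inverse signed_one signed_inv signed_mul.
Proof.
case=> p e; congr pair => /=; first by rewrite mulgV.
by apply/ffunP=> i; rewrite !ffunE permK addbb.
Qed.

HB.instance Definition _ :=
  Finite_isGroup.Build (signed_perm n) signed_mulA signed_mul1 signed_mulV.

Fact ord_pred_subproof (i : 'I_n) : (i.-1 < n)%N.
Proof. exact: leq_ltn_trans (leq_pred i) (ltn_ord i). Qed.
Definition prev_ord (i : 'I_n) : 'I_n := Ordinal (ord_pred_subproof i).

(* Positions and values are shifted by one: for [i >= 1] the simple
   transposition of index [i] exchanges the ordinals [i.-1] and [i]. *)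
Definition simple_refl (i : 'I_n) : W :=
  if i == 0%N :> nat then (1%g, [ffun j => j == i])
  else (tperm (prev_ord i) i, [ffun => false]).

Definition longest : W := (1%g, [ffun => true]).

Definition word_prod (a : seq 'I_n) : W := (\prod_(i <- a) simple_refl i)%g.

Definition reduced_word (a : seq 'I_n) (w : W) : bool :=
  (word_prod a == w) &&
  [forall r : 'I_(size a), forall b : r.-tuple 'I_n, word_prod b != w].

Fact simple_refl_gen : <<[set simple_refl i | i : 'I_n]>>%g = [set: W].
Proof.
apply/eqP; rewrite eqEsubset subsetT /=; apply/subsetP => w _.
set G := (generated _).
have Gs i : simple_refl i \in G by rewrite mem_gen // imset_f.
have pairE (w1 w2 : W) : w1.1 = w2.1 -> w1.2 =1 w2.2 -> w1 = w2.
  by case: w1 w2 => [p e] [q f] /= -> /ffunP ->.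
have mulE (w1 w2 : W) : (w1 * w2)%g = signed_mul w1 w2 by [].
have [z _|no_ord] := pickP 'I_n; last first.
  suff -> : w = 1%g by rewrite group1.
  by apply: pairE => [|i]; [apply/permP=> i|]; have := no_ord i.
pose z0 : 'I_n := Ordinal (leq_ltn_trans (leq0n z) (ltn_ord z)).
pose lft p : W := (p, [ffun => false]).
have lftM : {morph lft : p q / (p * q)%g >-> (q * p)%g}.
  by move=> p q; rewrite mulE; apply: pairE => // i; rewrite !ffunE.
have Gt0 k : forall j : 'I_n, j = k :> nat -> lft (tperm z0 j) \in G.
  elim: k => [|k IHk] j jk.
    have -> : j = z0 by apply: val_inj.
    suff -> : lft (tperm z0 z0) = 1%g by rewrite group1.
    by apply: pairE => [|i] //=; rewrite tperm1.
  have pj : prev_ord j = k :> nat by rewrite /= jk.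
  have Gj := Gs j; rewrite /simple_refl jk /= -/(lft _) in Gj.
  have Gp := IHk _ pj.
  have [pz|pz] := eqVneq z0 (prev_ord j); first by rewrite pz.
  have jz : j != z0 by rewrite -val_eqE /= jk.
  have -> : tperm z0 j = (tperm z0 (prev_ord j) ^ tperm (prev_ord j) j)%g.
    by rewrite tpermJ tpermL tpermD // eq_sym.
  by rewrite /conjg tpermV !lftM !groupM.
have Gt p : lft p \in G.
  have : p \in <<[set tperm z0 y | y in 'I_n]>>%g by rewrite gen_tperm inE.
  case/gen_prodgP=> k [c Hc ->].
  have lft1 : lft 1%g = 1%g by [].
  elim: k c Hc => [|k IHk] c Hc; first by rewrite big_ord0 lft1 group1.
  rewrite big_ord_recl lftM groupM //; first by apply: IHk => i; apply: Hc.
  by case/imsetP: (Hc ord0) => y _ ->; apply: Gt0.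
pose flip j : W := (1%g, [ffun k => k == j]).
have Gflip j : flip j \in G.
  have -> : flip j = (lft (tperm z0 j) * simple_refl z0 * lft (tperm z0 j))%g.
    rewrite /simple_refl /= !mulE; apply: pairE => [|i] /=.
      by rewrite mul1g tperm2.
    rewrite !ffunE /= addbF.
    by rewrite -(inj_eq (@perm_inj _ (tperm z0 j)) i j) tpermR.
  by rewrite !groupM ?Gs ?Gt.
have Gsgn k : forall e : {ffun 'I_n -> bool}, #|[pred i | e i]| = k ->
    ((1%g, e) : W) \in G.
  elim: k => [|k IHk] e ek.
    suff -> : ((1%g, e) : W) = 1%g by rewrite group1.
    apply: pairE => [|i] //=; rewrite ffunE; apply/negbTE/negP => ei.
    by have := card0_eq ek i; rewrite inE ei.
  have [i ei] : exists i, e i.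
    by apply/existsP; have /card_gt0P[i ei] : (0 < #|[pred i | e i]|)%N;
       [rewrite ek | apply/existsP; exists i].
  pose f : {ffun 'I_n -> bool} := [ffun j => (j != i) && e j].
  have -> : ((1%g, e) : W) = (((1%g, f) : W) * flip i)%g.
    rewrite mulE; apply: pairE => [|j] /=; first by rewrite mulg1.
    by rewrite !ffunE /= perm1; case: eqP => [->|_]; rewrite ?ei ?addbF.
  apply: (groupM _ (Gflip i)); apply: IHk; apply: succn_inj.
  rewrite -ek [in RHS](cardD1 i).
  have -> : (i \in [pred i | e i]) = true by rewrite inE.
  by congr _.+1; apply: eq_card => j; rewrite !inE ffunE.
have -> : w = (lft w.1 * ((1%g, w.2) : W))%g.
  rewrite mulE; apply: pairE => [|i] /=; first by rewrite mul1g.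
  by rewrite !ffunE addbF.
by rewrite groupM // ?Gt // (Gsgn _ _ erefl).
Qed.

Fact reduced_word_ex (w : W) : exists a, reduced_word a w.
Proof.
have [a0 a0w] : exists a, word_prod a == w.
  have : w \in <<[set simple_refl i | i : 'I_n]>>%g by rewrite simple_refl_gen inE.
  case/gen_prodgP=> k [c Hc ->].
  elim: k c Hc => [|k IHk] c Hc.
    by exists [::]; rewrite /word_prod big_nil big_ord0.
  have [a /eqP aE] := IHk (fun i => c (lift ord0 i)) (fun i => Hc _).
  have /imsetP[i _ ci] := Hc ord0.
  by exists (i :: a); rewrite /word_prod big_cons big_ord_recl -ci -aE.
have exr : exists r, [exists b : r.-tuple 'I_n, word_prod b == w].
  by exists (size a0); apply/existsP; exists (in_tuple a0).
case: (ex_minnP exr) => r /existsP[b bw] minr.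
exists b; rewrite /reduced_word bw /=.
apply/forallP=> [[r' /= lt_r']]; apply/forallP=> b'; apply/negP=> b'w.
have := minr r'; rewrite leqNgt -(size_tuple b) lt_r' => /(_ _)/negP[] //.
by apply/existsP; exists b'.
Qed.

End SignedPerm.

Section PartitionPerm.
Variables (n : nat) (lambda : strict_partition n).

Definition part_perm_seq : seq 'I_n := rev (enum lambda) ++ enum (compl lambda).

Fact part_perm_seq_uniq : uniq part_perm_seq.
Proof.
rewrite cat_uniq rev_uniq !enum_uniq andbT /=; apply/hasPn=> i.
by rewrite mem_rev !mem_enum inE.
Qed.
Fact size_part_perm_seq : size part_perm_seq = n.
Proof. by rewrite size_cat size_rev -!cardE cardsC card_ord. Qed.
Fact part_perm_inj : injective (fun i : 'I_n => nth i part_perm_seq i).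
Proof.
move=> i j; rewrite (set_nth_default i j) ?size_part_perm_seq // => /eqP.
by rewrite nth_uniq ?size_part_perm_seq ?part_perm_seq_uniq // => /eqP/val_inj.
Qed.

(* In one-line notation: the parts of [lambda] in decreasing order, barred,
   then the parts of the complement in increasing order. *)
Definition part_perm : signed_perm n :=
  (perm part_perm_inj, [ffun i : 'I_n => (i < len lambda)%N]).

End PartitionPerm.

(** * Double Schubert polynomials of type B

    They are defined over a coefficient ring [K], with [Y] a sequence of
    elements of [K]; the double Schubert polynomials proper are obtained for
    [K = Z[1/2][Y]] and [Y] the sequence [Yvars n] of its variables. *)

Section DoubleSchubert.
Variables (K : idomainType) (n : nat).
Implicit Types (i j : 'I_n) (f g : {mpoly K[n]}) (w : signed_perm n) (Y : seq K).

Definition Xvars : seq {mpoly K[n]} := [seq 'X_i | i <- enum 'I_n].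

(* The left action of signed permutations: [w] sends [x_i] to [x_(w_i)], where
   [x_(-j) = - x_j]. *)
Definition wact w f : {mpoly K[n]} :=
  f \mPo [tuple (-1) ^+ w.2 i * 'X_(w.1 i) | i < n].

Definition ddiff_den i : {mpoly K[n]} :=
  if i == 0%N :> nat then 'X_i else 'X_(prev_ord i) - 'X_i.

Fact ddiff_den_neq0 i : ddiff_den i != 0.
Proof.
apply/eqP=> /(congr1 (mcoeff U_(i)%MM)); rewrite mcoeff0 /ddiff_den.
case: ifP => [_|i0]; first by rewrite mcoeffX eqxx; apply/eqP/oner_neq0.
rewrite mcoeffB !mcoeffX eqxx; case: eqP => [E|_]; last first.
  by rewrite sub0r; apply/eqP; rewrite oppr_eq0 oner_neq0.
have /eqP := congr1 (fun m : 'X_{1..n} => m i) E; rewrite !mnmE eqxx eqb1 -val_eqE /=.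
by case: (val i) i0 => //= k _; rewrite ltn_eqF.
Qed.

Fact ddiff_ex i f : exists g, g * ddiff_den i == f - wact (simple_refl i) f.
Proof.
pose D f := exists g, g * ddiff_den i = f - wact (simple_refl i) f.
suff [g gE] : D f by exists g; apply/eqP.
have D0 (c : K) : D c%:MP.
  by exists 0; rewrite /wact comp_mpolyC subrr mul0r.
have DD f1 f2 : D f1 -> D f2 -> D (f1 + f2).
  move=> [g1 E1] [g2 E2]; exists (g1 + g2).
  by rewrite mulrDl E1 E2 /wact comp_mpolyD opprD addrACA.
have DM f1 f2 : D f1 -> D f2 -> D (f1 * f2).
  move=> [g1 E1] [g2 E2]; exists (g1 * f2 + wact (simple_refl i) f1 * g2).
  rewrite mulrDl mulrAC E1 -mulrA E2 /wact rmorphM /= mulrBl mulrBr.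
  by rewrite addrA subrK.
have DX j : D 'X_j.
  rewrite /D /wact comp_mpolyXU -tnth_nth tnth_mktuple /simple_refl /ddiff_den.
  case: ifP => [_|_] /=.
    rewrite ffunE perm1; case: eqP => [->|_]; last first.
      by exists 0; rewrite mul0r mul1r subrr.
    by exists 2%:R; rewrite mulN1r opprK mulr_natl mulr2n.
  rewrite ffunE mul1r; case: tpermP => [->|->|_ _].
  - by exists 1; rewrite mul1r.
  - by exists (-1); rewrite mulN1r opprB.
  - by exists 0; rewrite mul0r subrr.
elim/mpolyind: f => [|c m p _ _ Dp]; first by rewrite -(mpolyC0 n); apply: D0.
apply: (DD _ _ _ Dp); rewrite -mul_mpolyC mpolyXE_id; apply: (DM _ _ (D0 c)).
apply: (big_ind D _ DM) => [|k _]; first by rewrite -(mpolyC1 n); apply: D0.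
elim: (m k) => [|e IHe]; first by rewrite expr0 -(mpolyC1 n); apply: D0.
by rewrite exprS; apply: (DM _ _ (DX k) IHe).
Qed.

(* The quotient of [f - s_i f] by [x_i - x_(i+1)] or [x_1]; it is unique since
   [{mpoly K[n]}] is an integral domain. *)
Definition ddiff i f : {mpoly K[n]} := xchoose (ddiff_ex i f).

Fact ddiffP i f : ddiff i f * ddiff_den i = f - wact (simple_refl i) f.
Proof. exact/eqP/(xchooseP (ddiff_ex i f)). Qed.

Fact ddiff_uniq i f g : g * ddiff_den i = f - wact (simple_refl i) f -> g = ddiff i f.
Proof. by move=> E; exact: (mulIf (ddiff_den_neq0 i) (etrans E (esym (ddiffP i f)))). Qed.

Definition ddiff' i f : {mpoly K[n]} :=
  if i == 0%N :> nat then ddiff i f else - ddiff i f.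

(* The choice of the reduced word is immaterial, by the braid relations. *)
Definition ddiff'_perm w f : {mpoly K[n]} :=
  foldr ddiff' f (xchoose (reduced_word_ex w)).

Definition Delta Y : {mpoly K[n]} :=
  \prod_(i < n) \prod_(j < n | (i.+1 + j.+1 <= n)%N) ('X_i - (Y`_j)%:MP).

Definition PtildeXY Y : {mpoly K[n]} :=
  \sum_(lambda : strict_partition n)
    Ptilde lambda Xvars * (Ptilde (compl lambda) Y)%:MP.

Definition dSchubertB Y w : {mpoly K[n]} :=
  (-1) ^+ (n * n.-1)./2 *
  ddiff'_perm (w^-1 * longest n)%g (Delta Y * PtildeXY Y).

End DoubleSchubert.

Definition Yvars (n : nat) : seq {mpoly Zhalf[n]} := [seq 'X_i | i <- enum 'I_n].

(* Main.v *)
Require Import Defs.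
From HB Require Import structures.
From mathcomp Require Import all_boot all_order all_algebra all_fingroup.
From mathcomp Require Import mpoly.
From mathcomp Require Import zify ring.

Set Implicit Arguments.
Unset Strict Implicit.
Unset Printing Implicit Defensive.

Import Order.TTheory GRing.Theory Num.Theory.
Local Open Scope ring_scope.

(** Two facts make the formula true.

    First, the Grassmannian signed permutation [part_perm lambda] is reached from
    the longest element [(-1, ..., -n)] by processing the values [1, ..., n] in
    this order, the value [r] being in front of the unprocessed ones when its
    turn comes.  If [r] is a part of [lambda], it moves to the right of the other
    unprocessed values; otherwise [s_0] removes its bar and it moves to the end.
    Let [phi_d x = (x - y_1) ... (x - y_d)].  The polynomial is a product of a
    staircase [phi_(n-r) x_1 * phi_(n-r-1) x_2 * ...] and of a polynomial [G]
    that is symmetric in [X].  Each of these moves applies a row of consecutive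
    divided differences, through which the tail of the staircase can be pulled
    ([ddrow_stair]): a move of the first kind gives the shorter staircase and the
    same [G], one of the second kind replaces [G] by [nabla (phi_(n-r) x_1 * G)],
    where [nabla] is the composite of the divided differences of indices
    [0, 1, ..., n-1], in this order ([reach_path]).  It follows that, up to sign,
    the double Schubert polynomial arises from [PtildeXY] by one operator
    [nabla (phi_(n-r) x_1 * _)] for each part [r] of the complement of [lambda].
    That any reduced word may be used is Matsumoto's theorem ([matsumoto]), proved
    here together with the braid relations of the divided differences.

    Second, [nabla (x_1 ^ (n - b) * _)] removes the part [b] from
    [Ptilde alpha X], with the sign of its position, and gives zero if there is
    no such part ([nabla_Ptilde]).  Indeed, changing the sign of [x_1] changes the
    matrix of the polynomials [Qtilde2] by a matrix of rank two, built from the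
    elementary symmetric polynomials in [x_1, ..., x_n] and in
    [x_2, ..., x_n] ([sa0_Qtilde2]).  Its effect on a Pfaffian is a double
    contraction ([pfseq_rank2]).  One of the contractions becomes, after the
    remaining divided differences, the removal of [b], because the powers of
    [x_1] and the elementary symmetric polynomials in [x_2, ..., x_n] are
    biorthogonal ([ddrow_pow_elemsym]); the other one is the expansion of a
    Pfaffian along the column of a zero part ([nabla_Qtilde]).

    By Vieta's formula [phi_(n-r) x_1] is a combination of the powers
    [x_1 ^ (n - b)] whose coefficients are elementary symmetric polynomials in
    [y_1, ..., y_(n-r)].  On the coefficients of [PtildeXY] the operators act by
    the insertion of parts; as insertions anticommute, their composite is a sum
    over sets [beta] of inserted parts, weighted by determinants
    ([foldr_insert]).  It remains to compare the signs ([collect_signs]). *)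

(** * Contractions and Pfaffians *)

Section Contraction.
Variables (T : Type) (A : comNzRingType).
Implicit Types (a b : T -> A) (F G : seq T -> A) (s t : seq T) (x z : T).

(** Interior multiplication by the functional [a] in an exterior algebra, whose
    elements are represented by functions of a sequence of indices. *)
Fixpoint contract a F s : A :=
  if s is x :: s' then a x * F s' - contract a (fun u => F (x :: u)) s' else 0.

Lemma eq_contract a b F G s : a =1 b ->
  (forall u, (size u).+1 = size s -> F u = G u) ->
  contract a F s = contract b G s.
Proof.
move=> ab; elim: s F G => //= x s IH F G FG; rewrite ab FG //; congr (_ - _).
by apply: IH => u us; apply: FG; rewrite /= us.
Qed.

Lemma contractD a F G s :
  contract a (fun u => F u + G u) s = contract a F s + contract a G s.
Proof. by elim: s F G => [|x s IH] F G /=; rewrite ?addr0 // IH; ring. Qed.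

Lemma contractZ a c F s : contract a (fun u => c * F u) s = c * contract a F s.
Proof. by elim: s F => [|x s IH] F /=; rewrite ?mulr0 // IH; ring. Qed.

Lemma contractN a F s : contract a (fun u => - F u) s = - contract a F s.
Proof. by elim: s F => [|x s IH] F /=; rewrite ?oppr0 // IH; ring. Qed.

Lemma contractB a F G s :
  contract a (fun u => F u - G u) s = contract a F s - contract a G s.
Proof. by rewrite contractD contractN. Qed.

Lemma contract0 a F s :
  (forall u, (size u).+1 = size s -> F u = 0) -> contract a F s = 0.
Proof.
move=> F0; rewrite (@eq_contract a a F (fun u => 0 * F u) s) //.
  by rewrite contractZ mul0r.
by move=> u us; rewrite F0 // mulr0.
Qed.

Lemma contract_lin a b c d F s :
  contract (fun x => c * a x + d * b x) F s =
  c * contract a F s + d * contract b F s.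
Proof. by elim: s F => [|x s IH] F /=; rewrite ?mulr0 ?addr0 // IH; ring. Qed.

Lemma contract_scale a c F s : contract (fun x => c * a x) F s = c * contract a F s.
Proof. by elim: s F => [|x s IH] F /=; rewrite ?mulr0 // IH; ring. Qed.

Lemma contractC a b F s :
  contract a (contract b F) s = - contract b (contract a F) s.
Proof.
elim: s F => [|x s IH] F /=; first by rewrite oppr0.
by rewrite !contractB !contractZ IH; ring.
Qed.

Lemma contract_sq a F s : contract a (contract a F) s = 0.
Proof.
elim: s F => [|x s IH] F //=.
by rewrite !contractB !contractZ IH; ring.
Qed.

Lemma contract_rcons a F s z :
  contract a F (rcons s z) =
  contract a (fun u => F (rcons u z)) s + (-1) ^+ size s * (a z * F s).
Proof.
elim: s F => [|x s IH] F /=; first by rewrite expr0; ring.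
by rewrite IH exprS; ring.
Qed.

Lemma contract_nth a F s (k : nat) z : (k < size s)%N ->
  (forall i, (i < size s)%N -> i != k -> a (nth z s i) = 0) ->
  contract a F s = (-1) ^+ k * (a (nth z s k) * F (take k s ++ drop k.+1 s)).
Proof.
elim: s k F => //= x s IH [|k] F ks a0 /=.
  rewrite drop0 expr0 mul1r [X in _ - X](_ : _ = 0) ?subr0 //.
  clear IH ks; have {}a0 i : (i < size s)%N -> a (nth z s i) = 0.
    by move=> is1; apply: (a0 i.+1).
  elim: s {F}(fun u => F (x :: u)) a0 => //= y s IH F a0.
  by rewrite (a0 0%N) // mul0r IH ?subr0 // => i is1; apply: (a0 i.+1).
rewrite (a0 0%N) // (IH k) //; first by rewrite exprS; ring.
by move=> i is1 ik; apply: (a0 i.+1).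
Qed.

Lemma contract_eq0 a F s z :
  (forall i, (i < size s)%N -> a (nth z s i) = 0) -> contract a F s = 0.
Proof.
elim: s F => //= y s IH F a0.
by rewrite (a0 0%N) // mul0r IH ?subr0 // => i is1; apply: (a0 i.+1).
Qed.

(** The Pfaffian, by expansion along the first row.  The recursion is on half
    the length of the sequence; sequences of any other length give 0. *)
Fixpoint pfseq (f : T -> T -> A) (m : nat) s : A :=
  match m, s with
  | 0, [::] => 1
  | m'.+1, x :: s' => contract (f x) (pfseq f m') s'
  | _, _ => 0
  end.

Lemma eq_pfseq (f g : T -> T -> A) m s : f =2 g -> pfseq f m s = pfseq g m s.
Proof.
move=> fg; elim: m s => [|m IH] [|x s] //=.
by apply: eq_contract => [y|u _]; [apply: fg | apply: IH].
Qed.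

(** The Pfaffian is the top coefficient of an exponential in the exterior
    algebra, and the 2-form [a /\ b] has square zero: only one correction term
    survives.  The proof is an induction in which the contractions with [a] and
    [b] anticommute with the one by the first row. *)
Lemma pfseq_rank2 (f : T -> T -> A) a b m s :
  size s = m.+1.*2 ->
  pfseq (fun x y => f x y + (a x * b y - b x * a y)) m.+1 s =
  pfseq f m.+1 s + contract a (contract b (pfseq f m)) s.
Proof.
set f' := fun x y => _.
elim: m s => [|m IH] s.
  case: s => [|x [|y [|]]] //= _.
  by rewrite /f'; ring.
case: s => [|x s] // [sz].
have f'E y : f' x y = 1 * f x y + 1 * (a x * b y + (- b x) * a y).
  by rewrite /f'; ring.
rewrite [LHS]/= (eq_contract (F := pfseq f' m.+1) (G := fun u => pfseq f m.+1 u +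
   contract a (contract b (pfseq f m)) u) (s := s) f'E); last first.
  by move=> u us; apply: IH; lia.
rewrite (contract_lin (f x) (fun y => a x * b y + (- b x) * a y)) contract_lin.
rewrite !contractD.
rewrite [contract b (contract a _) s]contractC.
rewrite (@contract0 a (contract b (contract b _))); last first.
  by move=> u _; apply: contract_sq.
rewrite contract_sq.
have -> : contract a (contract b (pfseq f m.+1)) (x :: s) =
    a x * contract b (pfseq f m.+1) s - b x * contract a (pfseq f m.+1) s
    + contract (f x) (contract a (contract b (pfseq f m))) s.
  rewrite [LHS]/= contractB contractZ (contractC (f x) a).
  rewrite (eq_contract (F := contract (f x) (contract b _))
    (G := fun u => - contract b (contract (f x) (pfseq f m)) u) (s := s)
    (frefl a)); last by move=> u _; apply: contractC.
  rewrite contractN; ring.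
rewrite -[pfseq f m.+2 _]/(contract (f x) (pfseq f m.+1) s); ring.
Qed.

(** Expansion along the last column, from the expansion along the first row: the
    contractions by a row and by a column anticommute. *)
Lemma pfseq_rcons (f : T -> T -> A) m s z : size s = m.*2.+1 ->
  pfseq f m.+1 (rcons s z) = contract (f^~ z) (pfseq f m) s.
Proof.
elim: m s => [|m IH] [|x s] // [sz].
  by case: s sz => //= _; rewrite /=; ring.
rewrite rcons_cons [LHS]/= contract_rcons.
rewrite (eq_contract (G := contract (f^~ z) (pfseq f m)) (s := s) (frefl (f x))).
  rewrite contractC [contract _ _ (x :: s)]/= sz -signr_odd /= odd_double.
  by rewrite expr0 mul1r addrC.
by move=> u us; apply: IH; lia.
Qed.

End Contraction.

Lemma rmorph_contract (T : Type) (A B : comNzRingType) (h : {rmorphism A -> B})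
    (a : T -> A) F s :
  h (contract a F s) = contract (h \o a) (h \o F) s.
Proof.
elim: s F => [|x s IH] F /=; first by rewrite rmorph0.
by rewrite rmorphB rmorphM IH.
Qed.

Lemma rmorph_pfseq (T : Type) (A B : comNzRingType) (h : {rmorphism A -> B})
    (f : T -> T -> A) m s :
  h (pfseq f m s) = pfseq (fun x y => h (f x y)) m s.
Proof.
elim: m s => [|m IH] [|x s] /=; rewrite ?rmorph1 ?rmorph0 //.
by rewrite rmorph_contract; apply: eq_contract => [y|u _] /=.
Qed.

(** * Pfaffians as sums over perfect matchings *)

Lemma lift_perm_reindex (A : nmodType) n (i j : 'I_n.+1) (P : pred 'S_n.+1)
    (F : 'S_n.+1 -> A) :
  \sum_(s | P s && (s i == j)) F s =
  \sum_(t | P (lift_perm i j t)) F (lift_perm i j t).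
Proof.
rewrite (reindex (lift_perm i j)) /=; last first.
  pose ulsf (i : 'I_n.+1) (s : 'S_n.+1) k := odflt k (unlift (s i) (s (lift i k))).
  have ulsfK i' (s : 'S_n.+1) k : lift (s i') (ulsf i' s k) = s (lift i' k).
    rewrite /ulsf; have := neq_lift i' k.
    by rewrite -(can_eq (permK s)) => /unlift_some[] ? ? ->.
  have inj_ulsf s : injective (ulsf i s).
    by apply: can_inj (ulsf (s i) s^-1%g) _ => k'; rewrite {1}/ulsf ulsfK !permK liftK.
  exists (fun s => perm (inj_ulsf s)) => [s _ | s].
    by apply/permP=> k'; rewrite permE /ulsf lift_perm_lift lift_perm_id liftK.
  rewrite inE => /andP[_ /eqP si]; apply/permP=> k.
  case: (unliftP i k) => [k'|] ->; rewrite ?lift_perm_id //.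
  by rewrite lift_perm_lift -si permE ulsfK.
by apply: eq_bigl => s; rewrite lift_perm_id eqxx andbT.
Qed.

Lemma contractE (T : Type) (A : comNzRingType) (a : T -> A) F s z :
  contract a F s =
  \sum_(j < size s) (-1) ^+ j * (a (nth z s j) * F (take j s ++ drop j.+1 s)).
Proof.
elim: s F => [|x s IH] F /=; first by rewrite big_ord0.
rewrite big_ord_recl /= drop0 expr0 mul1r IH -sumrN; congr (_ + _).
by apply: eq_bigr => i _; rewrite /bump /= exprS; ring.
Qed.

Lemma nth_del (T : Type) (z : T) s j i : (j < size s)%N ->
  nth z (take j s ++ drop j.+1 s) i = nth z s (bump j i).
Proof.
move=> js; rewrite nth_cat size_take js /bump.
case: ltnP => ij; first by rewrite nth_take.
by rewrite nth_drop; congr nth; lia.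
Qed.

Section PfaffianExpansion.
Variable A : comUnitRingType.

Lemma even_ord_lift m (i : 'I_m) :
  even_ord (lift ord0 i) = lift ord0 (lift ord0 (even_ord i)).
Proof. by apply: val_inj; rewrite /= /bump /=; lia. Qed.

Lemma odd_ord_lift m (i : 'I_m) :
  odd_ord (lift ord0 i) = lift ord0 (lift ord0 (odd_ord i)).
Proof. by apply: val_inj; rewrite /= /bump /=; lia. Qed.

(** Every matching pairs [0] with some [j.+1]; [t] is the matching induced on the
    other indices. *)
Definition match0 m (j : 'I_m.*2.+1) (t : 'S_m.*2) : 'S_m.+1.*2 :=
  lift_perm ord0 ord0 (lift_perm ord0 j t).

Lemma match0_even0 m (j : 'I_m.*2.+1) t : match0 j t (even_ord ord0) = ord0.
Proof.
have -> : even_ord (@ord0 m) = ord0 by apply: val_inj.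
by rewrite lift_perm_id.
Qed.

Lemma match0_odd0 m (j : 'I_m.*2.+1) t : match0 j t (odd_ord ord0) = lift ord0 j.
Proof.
have -> : odd_ord (@ord0 m) = lift ord0 ord0 by apply: val_inj.
by rewrite lift_perm_lift lift_perm_id.
Qed.

Lemma match0_even m (j : 'I_m.*2.+1) t i :
  match0 j t (even_ord (lift ord0 i)) = lift ord0 (lift j (t (even_ord i))).
Proof. by rewrite even_ord_lift !lift_perm_lift. Qed.

Lemma match0_odd m (j : 'I_m.*2.+1) t i :
  match0 j t (odd_ord (lift ord0 i)) = lift ord0 (lift j (t (odd_ord i))).
Proof. by rewrite odd_ord_lift !lift_perm_lift. Qed.

Lemma ltn_bump2 h i j : (bump h i < bump h j)%N = (i < j)%N.
Proof. by rewrite /bump; case: leqP; case: leqP; lia. Qed.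

Lemma matching_match0 m (j : 'I_m.*2.+1) t : matching (match0 j t) = matching t.
Proof.
apply/andP/andP => -[/forallP H1 /forallP H2]; split.
- apply/forallP=> i; have := H1 (lift ord0 i).
  by rewrite match0_even match0_odd /= !ltn_bump2.
- apply/forallP=> i; apply/forallP=> k; have /forallP/(_ (lift ord0 k)) := H2 (lift ord0 i).
  by rewrite !match0_even /= !ltn_bump2.
- apply/forallP=> i; case: (unliftP ord0 i) => [k|] ->.
    by rewrite match0_even match0_odd /= !ltn_bump2.
  by rewrite match0_even0 match0_odd0.
- apply/forallP=> i; apply/forallP=> k.
  case: (unliftP ord0 k) => [k'|] ->; last by rewrite ltn0.
  case: (unliftP ord0 i) => [i'|] ->; last by rewrite match0_even0 match0_even.
  by have /forallP/(_ k') := H2 i'; rewrite !match0_even /= !ltn_bump2.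
Qed.

Lemma matching0 m (s : 'S_m.+1.*2) : matching s -> s ord0 = ord0.
Proof.
case/andP=> /forallP H1 /forallP H2.
have E0 : even_ord (@ord0 m) = ord0 by apply: val_inj.
pose k : 'I_m.+1.*2 := (s^-1)%g ord0.
have sk : s k = ord0 by rewrite permKV.
have hk : (k./2 < m.+1)%N by have := ltn_ord k; lia.
have := odd_double_half k; case ok: (odd k) => /= kE.
  have Ek : k = odd_ord (Ordinal hk) by apply: val_inj; exact: esym kE.
  by have := H1 (Ordinal hk); rewrite -Ek sk ltn0.
have Ek : k = even_ord (Ordinal hk) by apply: val_inj; exact: esym kE.
have [k0|k0] := posnP k./2.
  have k0' : k = ord0 by apply: val_inj; rewrite -[LHS]kE k0.
  by move: sk; rewrite k0'.
by have /forallP/(_ (Ordinal hk)) := H2 ord0; rewrite -Ek sk E0 /= k0.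
Qed.

(** Sorting the matchings by the partner of the first index gives the expansion
    along the first row; the sign of [match0 j t] is [(-1) ^+ j] times that of
    [t]. *)
Lemma pfaffian_pfseq (T : Type) (f : T -> T -> A) (z : T) m s : size s = m.*2 ->
  pfaffian (\matrix_(i < m.*2, j < m.*2) f (nth z s i) (nth z s j)) = pfseq f m s.
Proof.
elim: m s => [|m IH] s.
  case: s => // _; rewrite /pfaffian /= (bigD1 1%g) /=; last first.
    by apply/andP; split; apply/forallP; case.
  rewrite odd_perm1 big_ord0 mulr1 big1 ?addr0 // => s /andP[_ /eqP[]].
  by apply/permP; case.
case: s => // x s [sz]; rewrite /pfaffian.
transitivity (\sum_(s0 : 'S_m.*2.+2 | matching (m := m.+1) s0 && (s0 ord0 == ord0))
  (-1) ^+ s0 * \prod_(i < m.+1)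
    f (nth z (x :: s) (s0 (even_ord i))) (nth z (x :: s) (s0 (odd_ord i)))).
  apply: eq_big => [s0|s0 _].
    by case: (boolP (matching s0)) => //= /matching0 ->; rewrite eqxx.
  by congr (_ * _); apply: eq_bigr => i _; rewrite mxE.
rewrite lift_perm_reindex (partition_big (fun s0 : 'S_m.*2.+1 => s0 ord0) xpredT) //=.
rewrite (contractE _ _ _ z) sz; apply: eq_bigr => j _.
rewrite lift_perm_reindex.
have szd : size (take j s ++ drop j.+1 s) = m.*2.
  by rewrite size_cat size_take size_drop sz; have := ltn_ord j; case: ifP; lia.
rewrite -(IH _ szd) /pfaffian !mulr_sumr.
apply: eq_big => [t|t _]; first exact: matching_match0.
rewrite big_ord_recl -/(match0 j t) match0_even0 match0_odd0 [nth _ _ ord0]/=.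
rewrite [nth z (x :: s) _]/= !odd_lift_perm /=.
have js : (j < size s)%N by rewrite sz.
set p := \prod_(i < m) _; set q := \prod_(i < m) _.
have -> : p = q by apply: eq_bigr => i _; rewrite mxE !nth_del // match0_even match0_odd.
by rewrite signr_addb signr_odd add0n -mulrA; congr (_ * _); rewrite mulrCA.
Qed.

End PfaffianExpansion.

Arguments pfseq : simpl never.

(** * Signed permutations of the variables *)

(** The simple reflections of such indices commute. *)
Definition far i j := (i.+1 < j)%N || (j.+1 < i)%N.

Section PolynomialAction.
Variables (K : idomainType) (n : nat).
Local Notation R := {mpoly K[n]}.
Implicit Types (f g : R) (i j k : nat).

HB.instance Definition _ (w : signed_perm n) :=
  GRing.RMorphism.copy (@wact K n w)
    (comp_mpoly [tuple (-1) ^+ w.2 i * 'X_(w.1 i) | i < n]).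

Definition xvar i : R := (Xvars K n)`_i.

Lemma xvar_ord (o : 'I_n) : xvar o = 'X_o.
Proof.
by rewrite /xvar /Xvars (nth_map o) ?size_enum_ord // nth_ord_enum.
Qed.

Lemma xvarE i (h : (i < n)%N) : xvar i = 'X_(Ordinal h).
Proof. by rewrite -xvar_ord. Qed.

Lemma xvar_default i : (n <= i)%N -> xvar i = 0.
Proof. by move=> h; rewrite /xvar nth_default // size_map size_enum_ord. Qed.

(** Indexing by naturals makes chains of consecutive operators easy to state;
    an index that is at least [n] stands for the identity, resp. for zero. *)
Definition srefl i : signed_perm n := oapp (@simple_refl n) 1%g (insub i).
Definition sact i : R -> R := wact (srefl i).
Definition ddn i f : R := if insub i is Some o then ddiff o f else 0.
Definition ddden i : R := if i == 0%N then xvar 0 else xvar i.-1 - xvar i.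

HB.instance Definition _ i := GRing.RMorphism.copy (sact i) (wact (srefl i)).

Lemma ddn_ord (o : 'I_n) f : ddn o f = ddiff o f.
Proof. by rewrite /ddn valK. Qed.

Lemma wactX w (o : 'I_n) : wact w ('X_o : R) = (-1) ^+ w.2 o * 'X_(w.1 o).
Proof. by rewrite /wact comp_mpolyXU -tnth_nth tnth_mktuple. Qed.

Lemma sactC i (c : K) : sact i c%:MP = c%:MP :> R.
Proof. exact: comp_mpolyC. Qed.

Lemma sact_xvar0 j : sact 0 (xvar j) = if j == 0%N then - xvar j else xvar j.
Proof.
have [jn|jn] := ltnP j n; last first.
  by rewrite xvar_default // raddf0 oppr0 if_same.
have n0 : (0 < n)%N by apply: leq_ltn_trans jn.
rewrite (xvarE jn) /sact /srefl insubT /= wactX /simple_refl /= ffunE perm1.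
by rewrite -val_eqE /=; case: eqP => _; rewrite ?expr0 ?mul1r // expr1 mulN1r.
Qed.

Lemma sact_xvarS i j : (i.+1 < n)%N ->
  sact i.+1 (xvar j) = xvar (if j == i then i.+1 else if j == i.+1 then i else j).
Proof.
move=> i1; have [jn|jn] := ltnP j n; last first.
  rewrite xvar_default // raddf0 ifN ?ifN ?xvar_default //; lia.
rewrite (xvarE jn) /sact /srefl insubT /= wactX /simple_refl /= ffunE expr0 mul1r.
have io : (i < n)%N by lia.
case: tpermP => [E|E|E1 E2].
- by have := congr1 val E => /= ->; rewrite eqxx (xvarE i1).
- have := congr1 val E => /= ->; rewrite -xvar_ord /=.
  by rewrite eqxx (gtn_eqF (ltnSn i)).
- rewrite -(xvarE jn) ifN ?ifN //; apply/eqP=> E.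
    by apply: E2; apply: val_inj.
  by apply: E1; apply: val_inj.
Qed.

Lemma ddden_neq0 i : (i < n)%N -> ddden i != 0.
Proof.
case: i => [|i] iN; have := ddiff_den_neq0 K (Ordinal iN);
  by rewrite /ddiff_den /ddden /= -!xvar_ord.
Qed.

Lemma ddnP i f : (i < n)%N -> ddn i f * ddden i = f - sact i f.
Proof.
move=> iN; rewrite /ddn /sact /srefl insubT /= -ddiffP /ddiff_den /ddden.
by case: i iN => [|i] iN /=; rewrite -!xvar_ord.
Qed.

Lemma ddn_out i f : (n <= i)%N -> ddn i f = 0.
Proof. by move=> ni; rewrite /ddn insubF // ltnNge ni. Qed.

Lemma rmorph_mpoly_eq (S : nzRingType) (h h' : {rmorphism R -> S}) :
  (forall c : K, h c%:MP = h' c%:MP) -> (forall j, h (xvar j) = h' (xvar j)) ->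
  h =1 h'.
Proof.
move=> hC hX; elim/mpolyind=> [|c m p _ _ IH]; first by rewrite !rmorph0.
rewrite !rmorphD IH -mul_mpolyC !rmorphM hC mpolyXE_id !rmorph_prod.
congr (_ * _ + _); apply: eq_bigr => o _.
by rewrite !rmorphXn -xvar_ord hX.
Qed.

Lemma sactK i : (i < n)%N -> involutive (sact i).
Proof.
move=> iN f; apply: (rmorph_mpoly_eq (h := sact i \o sact i) (h' := idfun)) => [c|j].
  by rewrite /= !sactC.
case: i iN => [|i] iN /=.
  by rewrite !sact_xvar0; case: ifP => j0; rewrite ?rmorphN /= sact_xvar0 j0 ?opprK.
rewrite !(sact_xvarS _ iN); congr xvar.
by do 2?case: eqP => [->|//]; rewrite ?eqxx //; do !case: eqP => //; lia.
Qed.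

Lemma sact_far i j f : (i < n)%N -> (j < n)%N -> far i j ->
  sact i (sact j f) = sact j (sact i f).
Proof.
move=> iN jN ij.
apply: (rmorph_mpoly_eq (h := sact i \o sact j) (h' := sact j \o sact i)) => [c|k].
  by rewrite /= !sactC.
wlog {ij} ij : i j iN jN / (i.+1 < j)%N.
  by move=> W; case/orP: ij => ij; [|symmetry]; apply: W.
case: j ij jN => [|j] ij jN; first (exfalso; lia).
rewrite /comp /=; case: i ij iN => [|i] ij iN.
  rewrite (sact_xvarS k jN) !sact_xvar0 (fun_if (sact j.+1)) raddfN /= !(sact_xvarS k jN).
  by do !case: eqP => //; (lia || (intros; exfalso; lia)).
rewrite !(sact_xvarS _ iN, sact_xvarS _ jN); congr xvar; do !case: eqP => //; lia.
Qed.


Lemma sact_braid i f : (i.+2 < n)%N ->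
  sact i.+1 (sact i.+2 (sact i.+1 f)) = sact i.+2 (sact i.+1 (sact i.+2 f)).
Proof.
move=> iN; have iN' := ltnW iN.
apply: (rmorph_mpoly_eq (h := sact i.+1 \o (sact i.+2 \o sact i.+1))
  (h' := sact i.+2 \o (sact i.+1 \o sact i.+2))) => [c|k].
  by rewrite /= !sactC.
rewrite /comp /= !(sact_xvarS _ iN, sact_xvarS _ iN'); congr xvar.
by do !case: eqP => //; lia.
Qed.

Lemma sact_braid0 f : (1 < n)%N ->
  sact 0 (sact 1 (sact 0 (sact 1 f))) = sact 1 (sact 0 (sact 1 (sact 0 f))).
Proof.
move=> nN.
apply: (rmorph_mpoly_eq (h := sact 0 \o (sact 1 \o (sact 0 \o sact 1)))
  (h' := sact 1 \o (sact 0 \o (sact 1 \o sact 0)))) => [c|k].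
  by rewrite /= !sactC.
rewrite /comp /=; case: k => [|[|k]].
- by rewrite !(sact_xvarS _ nN, sact_xvar0, raddfN) /= !(sact_xvarS _ nN, sact_xvar0, raddfN).
- by rewrite !(sact_xvarS _ nN, sact_xvar0, raddfN) /= !(sact_xvarS _ nN, sact_xvar0, raddfN).
- by rewrite !(sact_xvarS _ nN, sact_xvar0).
Qed.

End PolynomialAction.

(** What the calculus of divided differences uses of a polynomial ring: the
    variables, the action of the simple reflections and the defining property of
    the divided differences. *)
Record ddsystem (R : idomainType) (n : nat) := DDSystem {
  dds_x : nat -> R;
  dds_s : nat -> {rmorphism R -> R};
  dds_d : nat -> R -> R;
  sa_xv0 : forall j, dds_s 0 (dds_x j) = if j == 0%N then - dds_x j else dds_x j;
  sa_xvS : forall i j, (i.+1 < n)%N ->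
    dds_s i.+1 (dds_x j) = dds_x (if j == i then i.+1 else if j == i.+1 then i else j);
  saK : forall i f, (i < n)%N -> dds_s i (dds_s i f) = f;
  sa_far : forall i j f, (i < n)%N -> (j < n)%N -> far i j ->
    dds_s i (dds_s j f) = dds_s j (dds_s i f);
  sa_braid : forall i f, (i.+2 < n)%N ->
    dds_s i.+1 (dds_s i.+2 (dds_s i.+1 f)) = dds_s i.+2 (dds_s i.+1 (dds_s i.+2 f));
  sa_braid0 : forall f, (1 < n)%N ->
    dds_s 0 (dds_s 1 (dds_s 0 (dds_s 1 f))) = dds_s 1 (dds_s 0 (dds_s 1 (dds_s 0 f)));
  dds_den := fun i => if i == 0%N then dds_x 0 else dds_x i.-1 - dds_x i;
  dden_neq0 : forall i, (i < n)%N -> dds_den i != 0;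
  dd_out : forall i f, (n <= i)%N -> dds_d i f = 0;
  ddP : forall i f, (i < n)%N -> dds_d i f * dds_den i = f - dds_s i f }.

Definition mpoly_ddsystem (K : idomainType) (n : nat) : ddsystem {mpoly K[n]} n :=
  @DDSystem {mpoly K[n]} n (xvar K n) (fun i => sact i) (@ddn K n)
   (@sact_xvar0 K n) (fun i j h => @sact_xvarS K n i j h) (fun i f h => sactK h f)
   (@sact_far K n) (@sact_braid K n) (@sact_braid0 K n)
   (@ddden_neq0 K n) (@ddn_out K n) (@ddnP K n).

(** * Divided differences and braid relations *)

Section DividedDifferenceCalculus.
Variables (R : idomainType) (n : nat) (D : ddsystem R n).
Implicit Types (f g h : R) (i j k : nat).
Local Notation xv := (dds_x D).
Local Notation sa := (dds_s D).
Local Notation dd := (dds_d D).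
Local Notation dden := (dds_den D).

Lemma ddE i f g : (i < n)%N -> g * dden i = f - sa i f -> dd i f = g.
Proof. by move=> iN E; apply: (mulIf (dden_neq0 D iN)); rewrite ddP. Qed.

Lemma sa_dden i : (i < n)%N -> sa i (dden i) = - dden i.
Proof.
case: i => [|i] iN; rewrite /dds_den ?rmorphB /= ?sa_xv0 // !sa_xvS //.
by rewrite !eqxx (gtn_eqF (ltnSn i)) opprB.
Qed.

Lemma sa_xv_far i j : (i.+1 < n)%N -> j != i -> j != i.+1 -> sa i.+1 (xv j) = xv j.
Proof. by move=> i1 ji ji1; rewrite sa_xvS // (negbTE ji) (negbTE ji1). Qed.

Lemma sa_dden_far i j : (i < n)%N -> (j < n)%N -> far i j -> sa i (dden j) = dden j.
Proof.
rewrite /far /dds_den => iN jN ij.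
case: i ij iN => [|i] ij iN; case: j ij jN => [|j] ij jN //=.
- by rewrite rmorphB /= !sa_xv0; do !case: eqP => //; lia.
- by rewrite sa_xv_far //; lia.
- by rewrite rmorphB /= !sa_xv_far //; lia.
Qed.

Lemma ddD i f g : dd i (f + g) = dd i f + dd i g.
Proof.
have [iN|ni] := ltnP i n; last by rewrite !dd_out ?addr0.
by apply: ddE => //; rewrite mulrDl !ddP // rmorphD opprD addrACA.
Qed.

Lemma dd0 i : dd i 0 = 0.
Proof. by apply: (addIr (dd i 0)); rewrite -ddD !add0r. Qed.

HB.instance Definition _ i :=
  GRing.isNmodMorphism.Build R R (dd i) (conj (dd0 i) (ddD i)).

Lemma ddM i f g : (i < n)%N -> dd i (f * g) = dd i f * g + sa i f * dd i g.
Proof.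
move=> iN; apply: ddE => //.
by rewrite mulrDl mulrAC ddP // -mulrA ddP // rmorphM mulrBl mulrBr addrA subrK.
Qed.

Lemma dd_inv i f : sa i f = f -> dd i f = 0.
Proof.
have [iN|ni] := ltnP i n; last by rewrite dd_out.
by move=> E; apply: ddE => //; rewrite E mul0r subrr.
Qed.

Lemma dd_invl i f g : sa i f = f -> dd i (f * g) = f * dd i g.
Proof.
have [iN|ni] := ltnP i n; last by rewrite !dd_out ?mulr0.
by move=> E; rewrite ddM // dd_inv // E mul0r add0r.
Qed.

Lemma dd_invr i f g : sa i g = g -> dd i (f * g) = dd i f * g.
Proof. by move=> E; rewrite mulrC dd_invl // mulrC. Qed.

Lemma sa_dd i f : (i < n)%N -> sa i (dd i f) = dd i f.
Proof.
move=> iN; symmetry; apply: ddE => //.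
have := congr1 (sa i) (ddP D f iN).
rewrite rmorphM rmorphB saK // sa_dden // mulrN.
by move/eqP; rewrite eqr_oppLR opprB => /eqP.
Qed.

Lemma farC i j : far i j = far j i.
Proof. by rewrite /far orbC. Qed.

Lemma sa_dd_far i j f : (i < n)%N -> far i j -> sa i (dd j f) = dd j (sa i f).
Proof.
move=> iN ij; have [jN|nj] := ltnP j n; last by rewrite !dd_out ?raddf0.
symmetry; apply: ddE => //.
by rewrite -{1}(sa_dden_far iN jN ij) -rmorphM ddP // rmorphB (sa_far D f iN jN ij).
Qed.

Lemma dd_far i j f : far i j -> dd i (dd j f) = dd j (dd i f).
Proof.
move=> ij; have [iN|ni] := ltnP i n; last by rewrite !(dd_out _ _ ni) dd0.
have [jN|nj] := ltnP j n; last by rewrite !(dd_out _ _ nj) dd0.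
apply: ddE => //; rewrite sa_dd_far // -raddfB /= -(ddP D _ iN) dd_invr //.
by rewrite sa_dden_far // farC.
Qed.

Lemma sa_neq0 i f : (i < n)%N -> f != 0 -> sa i f != 0.
Proof. by move=> iN; apply: contraNneq => E; rewrite -(saK D f iN) E rmorph0. Qed.



(** Clearing the denominators one after the other turns both composites into the
    same alternating sum, over the dihedral group of order 6. *)
Lemma dd_alt3 i f : (i.+2 < n)%N ->
  let x := xv i in let y := xv i.+1 in let z := xv i.+2 in
  let s1 := sa i.+1 in let s2 := sa i.+2 in
  dd i.+1 (dd i.+2 (dd i.+1 f)) * ((x - y) * (x - z) * (y - z)) =
    f - s1 f - s2 f + s2 (s1 f) + s1 (s2 f) - s1 (s2 (s1 f)) /\
  dd i.+2 (dd i.+1 (dd i.+2 f)) * ((x - y) * (x - z) * (y - z)) =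
    f - s1 f - s2 f + s2 (s1 f) + s1 (s2 f) - s2 (s1 (s2 f)).
Proof.
move=> iN /=; have iN' := ltnW iN.
set x := xv i; set y := xv i.+1; set z := xv i.+2.
pose s1 := sa i.+1; pose s2 := sa i.+2; rewrite -/s1 -/s2.
have s1x : s1 x = y by rewrite /s1 sa_xvS // eqxx.
have s1y : s1 y = x by rewrite /s1 sa_xvS // eqxx gtn_eqF.
have s1z : s1 z = z by rewrite /s1 sa_xv_far //; lia.
have s2x : s2 x = x by rewrite /s2 sa_xv_far //; lia.
have s2y : s2 y = z by rewrite /s2 sa_xvS // eqxx.
have s2z : s2 z = y by rewrite /s2 sa_xvS // eqxx gtn_eqF.
have P1 g : dd i.+1 g * (x - y) = g - s1 g := ddP D g iN'.
have P2 g : dd i.+2 g * (y - z) = g - s2 g := ddP D g iN.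
have s1d g : s1 (dd i.+1 g) = dd i.+1 g := sa_dd g iN'.
have s2d g : s2 (dd i.+2 g) = dd i.+2 g := sa_dd g iN.
split.
  set g := dd i.+1 f; set h := dd i.+2 g.
  have Eg : g * (x - y) = f - s1 f by apply: P1.
  have Eh : h * (y - z) = g - s2 g by apply: P2.
  have := congr1 s2 Eg; rewrite !(rmorphM, rmorphB) s2x s2y => E2.
  have := congr1 s1 Eh; rewrite !(rmorphM, rmorphB) s1y s1z s1d -/g => E1.
  have := congr1 s1 E2; rewrite !(rmorphM, rmorphB) s1x s1z => E12.
  transitivity ((dd i.+1 h * (x - y)) * ((x - z) * (y - z))); first by ring.
  rewrite P1.
  transitivity ((h * (y - z)) * (x - z) - (s1 h * (x - z)) * (y - z)); first by ring.
  rewrite Eh E1.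
  transitivity (g * (x - y) - s2 g * (x - z) + s1 (s2 g) * (y - z)); first by ring.
  by rewrite Eg E2 E12; ring.
set g := dd i.+2 f; set h := dd i.+1 g.
have Eg : g * (y - z) = f - s2 f by apply: P2.
have Eh : h * (x - y) = g - s1 g by apply: P1.
have := congr1 s1 Eg; rewrite !(rmorphM, rmorphB) s1y s1z => E1.
have := congr1 s2 Eh; rewrite !(rmorphM, rmorphB) s2y s2x s2d -/g => E2.
have := congr1 s2 E1; rewrite !(rmorphM, rmorphB) s2x s2z => E21.
transitivity ((dd i.+2 h * (y - z)) * ((x - z) * (x - y))); first by ring.
rewrite P2.
transitivity ((h * (x - y)) * (x - z) - (s2 h * (x - z)) * (x - y)); first by ring.
rewrite Eh E2.
transitivity (g * (y - z) - s1 g * (x - z) + s2 (s1 g) * (x - y)); first by ring.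
by rewrite Eg E1 E21; ring.
Qed.

Lemma dd_braid i f : (i.+2 < n)%N ->
  dd i.+1 (dd i.+2 (dd i.+1 f)) = dd i.+2 (dd i.+1 (dd i.+2 f)).
Proof.
move=> iN; have iN' := ltnW iN; have [E1 E2] := dd_alt3 f iN.
have n01 : xv i - xv i.+1 != 0 := dden_neq0 D iN'.
have n12 : xv i.+1 - xv i.+2 != 0 := dden_neq0 D iN.
have n02 : xv i - xv i.+2 != 0.
  suff -> : xv i - xv i.+2 = sa i.+2 (xv i - xv i.+1) by apply: sa_neq0.
  by rewrite rmorphB (sa_xv_far (i := i.+1) (j := i) iN) ?sa_xvS ?eqxx //; lia.
apply: (mulIf (mulf_neq0 (mulf_neq0 n01 n02) n12)).
by rewrite E1 E2 sa_braid.
Qed.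

(** The analogue for the dihedral group of order 8.  Clearing all denominators
    brings in one of the simple roots twice, hence the common last factor. *)
Lemma dd_alt4 f : (1 < n)%N ->
  let x := xv 0 in let y := xv 1 in let s0 := sa 0 in let s1 := sa 1 in
  (dd 0 (dd 1 (dd 0 (dd 1 f))) * (x * y * (x - y) * (x + y))) * x =
    (s1 f - f + s0 f - s0 (s1 f) - s1 (s0 f) + s1 (s0 (s1 f))
     + s0 (s1 (s0 f)) - s0 (s1 (s0 (s1 f)))) * x /\
  (dd 1 (dd 0 (dd 1 (dd 0 f))) * (x * y * (x - y) * (x + y))) * (x - y) =
    (s1 f - f + s0 f - s0 (s1 f) - s1 (s0 f) + s1 (s0 (s1 f))
     + s0 (s1 (s0 f)) - s1 (s0 (s1 (s0 f)))) * (x - y).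
Proof.
move=> iN /=; have iN' := ltnW iN.
set x := xv 0; set y := xv 1.
pose s0 := sa 0; pose s1 := sa 1; rewrite -/s0 -/s1.
have s0x : s0 x = - x by rewrite /s0 sa_xv0.
have s0y : s0 y = y by rewrite /s0 sa_xv0.
have s1x : s1 x = y by rewrite /s1 sa_xvS.
have s1y : s1 y = x by rewrite /s1 sa_xvS.
have P0 g : dd 0 g * x = g - s0 g := ddP D g iN'.
have P1 g : dd 1 g * (x - y) = g - s1 g := ddP D g iN.
have s0d g : s0 (dd 0 g) = dd 0 g := sa_dd g iN'.
have s1d g : s1 (dd 1 g) = dd 1 g := sa_dd g iN.
have mE := (rmorphM, rmorphB, rmorphN).
split.
  set g := dd 1 f; set h := dd 0 g; set k := dd 1 h.
  have Eg : g * (x - y) = f - s1 f by apply: P1.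
  have Eh : h * x = g - s0 g by apply: P0.
  have Ek : k * (x - y) = h - s1 h by apply: P1.
  have := congr1 s0 Eg; rewrite !mE s0x s0y => Eg0.
  have := congr1 s1 Eg0; rewrite !mE s1x s1y => Eg10.
  have := congr1 s0 Eg10; rewrite !mE s0x s0y => Eg010.
  have := congr1 s1 Eh; rewrite !mE s1x s1d -/g => Eh1.
  have := congr1 s0 Eh1; rewrite !mE s0y => Eh01.
  have := congr1 s0 Ek; rewrite !mE s0x s0y s0d -/h => Ek0.
  transitivity ((dd 0 k * x) * (x * y * (x - y) * (x + y))); first by ring.
  rewrite P0.
  transitivity (((k * (x - y)) * (x + y) + (s0 k * (- x - y)) * (x - y)) * (x * y)).
    by ring.
  rewrite Ek Ek0.
  transitivity ((x + y) * ((h * x) * y - (s1 h * y) * x)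
    + (x - y) * ((h * x) * y - (s0 (s1 h) * y) * x)); first by ring.
  rewrite Eh Eh1 Eh01.
  transitivity (x * (- (g * (x - y)) + s0 g * (- x - y) - s1 (s0 g) * (- y - x)
    + s0 (s1 (s0 g)) * (- y - - x))); first by ring.
  by rewrite Eg Eg0 Eg10 Eg010; ring.
set g := dd 0 f; set h := dd 1 g; set k := dd 0 h.
have Eg : g * x = f - s0 f by apply: P0.
have Eh : h * (x - y) = g - s1 g by apply: P1.
have Ek : k * x = h - s0 h by apply: P0.
have := congr1 s1 Eg; rewrite !mE s1x => Eg1.
have := congr1 s0 Eg1; rewrite !mE s0y => Eg01.
have := congr1 s1 Eg01; rewrite !mE s1y => Eg101.
have := congr1 s0 Eh; rewrite !mE s0x s0y s0d -/g => Eh0.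
have := congr1 s1 Eh0; rewrite !mE s1x s1y => Eh10.
have := congr1 s1 Ek; rewrite !mE s1x s1d -/h => Ek1.
transitivity ((dd 1 k * (x - y)) * (x * y * (x - y) * (x + y))); first by ring.
rewrite P1.
transitivity (((k * x) * y - (s1 k * y) * x) * ((x - y) * (x + y))); first by ring.
rewrite Ek Ek1.
transitivity (y * (x + y) * (h * (x - y)) + y * (x - y) * (s0 h * (- x - y))
  - x * (x + y) * (h * (x - y)) - x * (x - y) * (s1 (s0 h) * (- y - x))).
  by ring.
rewrite Eh Eh0 Eh10.
transitivity ((x - y) * (- (g * x) + s1 g * y - s0 (s1 g) * y + s1 (s0 (s1 g)) * x)).
  by ring.
by rewrite Eg Eg1 Eg01 Eg101; ring.
Qed.

Lemma dd_braid0 f : (1 < n)%N ->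
  dd 0 (dd 1 (dd 0 (dd 1 f))) = dd 1 (dd 0 (dd 1 (dd 0 f))).
Proof.
move=> nN; have [E1 E2] := dd_alt4 f nN.
have nx : xv 0 != 0 := dden_neq0 D (ltnW nN).
have nb : xv 0 - xv 1 != 0 := dden_neq0 D nN.
have ny : xv 1 != 0.
  suff -> : xv 1 = sa 1 (xv 0) by apply: sa_neq0.
  by rewrite sa_xvS.
have na : xv 0 + xv 1 != 0.
  suff -> : xv 0 + xv 1 = - sa 0 (xv 0 - xv 1) by rewrite oppr_eq0 sa_neq0 // ltnW.
  by rewrite rmorphB !sa_xv0 /= opprB opprK addrC.
apply: (mulIf (mulf_neq0 (mulf_neq0 (mulf_neq0 nx ny) nb) na)).
by rewrite (mulIf nx E1) (mulIf nb E2) sa_braid0.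
Qed.

End DividedDifferenceCalculus.

(** * Reduced words of signed permutations *)

Section SignedSequences.
Implicit Types (s : seq int) (i j k : nat) (w : seq nat).

Fixpoint swapseq i s : seq int :=
  match i, s with
  | 0, [:: x, y & s'] => [:: y, x & s']
  | i'.+1, x :: s' => x :: swapseq i' s'
  | _, _ => s
  end.

Definition sgact i s : seq int :=
  if i is i'.+1 then swapseq i' s else if s is x :: s' then - x :: s' else s.

Definition ascent i s : bool :=
  if i is i'.+1 then s`_i' < s`_i else 0 < s`_0.

(** The number of positive roots that the signed permutation keeps positive,
    that is, the distance from the longest element. *)
Fixpoint colen s : nat :=
  if s is x :: s' then
    count (fun y => x < y) s' + count (fun y => 0 < x + y) s' + (0 < x)%R + colen s'
  else 0.

Lemma perm_swapseq i s : perm_eq (swapseq i s) s.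
Proof.
elim: i s => [|i IH] [|x s] //=; last by rewrite perm_cons.
by case: s => // y s; rewrite (perm_catCA [:: y] [:: x] s).
Qed.

Lemma size_act i s : size (sgact i s) = size s.
Proof.
case: i => [|i]; first by case: s.
by rewrite /sgact (perm_size (perm_swapseq _ _)).
Qed.

Lemma nth_swapseq i s k : (i.+1 < size s)%N ->
  (swapseq i s)`_k = s`_(if k == i then i.+1 else if k == i.+1 then i else k).
Proof.
elim: i s k => [|i IH] [|x s] [|k] //=; first by case: s.
  by case: s => // y s _; case: k.
by rewrite ltnS => /IH ->; rewrite !eqSS; case: ifP => // _; case: ifP.
Qed.

Lemma nth_act0 s k : (sgact 0 s)`_k = if k == 0%N then - s`_0 else s`_k.
Proof. by case: s => [|x s]; case: k => //=; rewrite oppr0. Qed.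

Lemma nth_actS i s k : (i.+1 < size s)%N ->
  (sgact i.+1 s)`_k = s`_(if k == i then i.+1 else if k == i.+1 then i else k).
Proof. exact: nth_swapseq. Qed.

Lemma sgactK i s : (i < size s)%N -> sgact i (sgact i s) = s.
Proof.
case: i => [|i] is1; first by case: s is1 => //= x s _; rewrite opprK.
apply: (@eq_from_nth _ 0); rewrite ?size_act // => k ks.
by rewrite !nth_actS ?size_act //; congr nth; do !case: eqP => //; lia.
Qed.

Lemma act_far i j s : (i < size s)%N -> (j < size s)%N -> far i j ->
  sgact i (sgact j s) = sgact j (sgact i s).
Proof.
move=> is1 js1 ij; apply: (@eq_from_nth _ 0); rewrite ?size_act // => k ks.
wlog {ij} ij : i j is1 js1 / (i.+1 < j)%N.
  by move=> W; case/orP: ij => ij; [|symmetry]; apply: W.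
case: j ij js1 => // j ij js1; case: i ij is1 => [|i] ij is1.
  rewrite nth_act0 !nth_actS ?size_act // !nth_act0.
  by do !case: eqP => //; (lia || (intros; exfalso; lia)).
by rewrite !nth_actS ?size_act //; congr nth; do !case: eqP => //; lia.
Qed.

Lemma act_braid i s : (i.+2 < size s)%N ->
  sgact i.+1 (sgact i.+2 (sgact i.+1 s)) = sgact i.+2 (sgact i.+1 (sgact i.+2 s)).
Proof.
move=> is1; have is2 := ltnW is1.
apply: (@eq_from_nth _ 0); rewrite ?size_act // => k ks.
by rewrite !nth_actS ?size_act //; congr nth; do !case: eqP => //; lia.
Qed.

Lemma act_braid0 s : (1 < size s)%N ->
  sgact 0 (sgact 1 (sgact 0 (sgact 1 s))) = sgact 1 (sgact 0 (sgact 1 (sgact 0 s))).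
Proof. by case: s => [|x [|y s]]. Qed.

Lemma colen_swapseq i s : (i.+1 < size s)%N ->
  (colen (swapseq i s) + (s`_i < s`_i.+1)%R = colen s + (s`_i.+1 < s`_i)%R)%N.
Proof.
elim: i s => [|i IH] [|x s] //=.
  case: s => // y s _ /=; rewrite ![y + x]addrC.
  set a := count _ s; set b := count _ s; set c := count _ s; set d := count _ s.
  lia.
by rewrite ltnS => /IH; rewrite !(seq.permP (perm_swapseq _ _)) => E; rewrite -!addnA E.
Qed.

Lemma colen_act i s : (i < size s)%N -> ascent i s -> (colen (sgact i s)).+1 = colen s.
Proof.
case: i => [|i] is1.
  case: s is1 => // x s _ /= x0.
  rewrite (eq_count (a2 := fun y => 0 < x + y)); last by move=> y /=; lia.
  rewrite (eq_count (a1 := fun y => 0 < - x + y) (a2 := fun y => x < y)); last first.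
    by move=> y /=; lia.
  have -> : (0 < - x) = false by lia.
  by rewrite x0 addn0 addn1 addSn [X in (X + _).+1]addnC.
rewrite /ascent => si; have := colen_swapseq is1; rewrite /sgact si; lia.
Qed.

Lemma leq_colen_act i s : (i < size s)%N -> ~~ ascent i s ->
  (colen s <= colen (sgact i s))%N.
Proof.
case: i => [|i] is1 asc.
  have [s0|s0] := eqVneq s`_0 0.
    by case: s s0 is1 {asc} => //= x s ->; rewrite oppr0.
  have asc' : ascent 0 (sgact 0 s) by move: asc s0; rewrite /ascent nth_act0 /=; lia.
  by rewrite -(colen_act _ asc') ?size_act // sgactK.
have := colen_swapseq is1; move: asc; rewrite /ascent /sgact => /negbTE ->; lia.
Qed.

Lemma colen_actS i s : (i < size s)%N -> (colen (sgact i s) <= (colen s).+1)%N.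
Proof.
move=> is1; have [asc|asc] := boolP (ascent i (sgact i s)).
  by rewrite -(colen_act _ asc) ?size_act // sgactK.
have := leq_colen_act _ asc; rewrite size_act sgactK // => /(_ is1); lia.
Qed.

Section States.
Variable n : nat.

(** One-line notations are reached from the one of the longest element; the last
    letter of a word acts first, as in a composite of operators. *)
Definition state0 : seq int := [seq - (i.+1)%:Z | i <- iota 0 n].
Definition state w : seq int := foldr sgact state0 w.
Definition signed_seq s := perm_eq [seq absz x | x <- s] (iota 1 n).

Lemma size_signed_seq s : signed_seq s -> size s = n.
Proof. by move/perm_size; rewrite size_map size_iota. Qed.

Lemma signed_seq_act i s : signed_seq s -> signed_seq (sgact i s).
Proof.
rewrite /signed_seq; case: i => [|i] /=; first by case: s => //= x s; rewrite abszN.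
by apply: perm_trans; apply/perm_map/perm_swapseq.
Qed.

Lemma signed_seq_state0 : signed_seq state0.
Proof.
rewrite /signed_seq /state0 -map_comp (iotaDl 1 0 n).
by rewrite (eq_map (g := addn 1)) // => i /=; rewrite abszN.
Qed.

Lemma signed_seq_state w : signed_seq (state w).
Proof. by elim: w => [|i w IH]; [apply: signed_seq_state0 | apply: signed_seq_act]. Qed.

Lemma size_state w : size (state w) = n.
Proof. exact/size_signed_seq/signed_seq_state. Qed.

Definition letters w := all (fun i => i < n)%N w.

Lemma colen_state0 : colen state0 = 0%N.
Proof.
suff H m k : colen [seq - (i.+1)%:Z | i <- iota k m] = 0%N by apply: H.
elim: m k => //= m IH k; rewrite IH addn0 !count_map.
have c0 (a : pred nat) : (forall j, (k < j)%N -> ~~ a j) -> count a (iota k.+1 m) = 0%N.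
  move=> a0; apply/eqP; rewrite -leqn0 leqNgt -has_count.
  by apply/hasPn => j; rewrite mem_iota => /andP[/a0].
by rewrite !c0 // => j /= kj; lia.
Qed.

Lemma colen_state w : letters w -> (colen (state w) <= size w)%N.
Proof.
elim: w => [|i w IH] /=; first by rewrite colen_state0.
case/andP=> iN /IH; rewrite -ltnS; apply: leq_trans.
by apply: colen_actS; rewrite size_state.
Qed.

(** Without ascents the entries are negative and decrease, so that their absolute
    values are [1, ..., n] in this order. *)
Lemma no_ascent s : signed_seq s -> (forall i, (i < n)%N -> ~~ ascent i s) ->
  s = state0.
Proof.
move=> gs na; have sz := size_signed_seq gs.
have mono k : (k < n)%N -> s`_k < 0 /\ forall m, (m <= k)%N -> s`_k <= s`_m.
  elim: k => [|k IH] kn.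
    split; last by move=> m; rewrite leqn0 => /eqP ->.
    have := na 0%N kn; rewrite /= -leNgt le_eqVlt => /orP[/eqP s0|//].
    have : 0%N \in iota 1 n; last by rewrite mem_iota.
    rewrite -(perm_mem gs); apply/mapP; exists s`_0; last by rewrite s0.
    by apply: mem_nth; rewrite sz.
  have [H1 H2] := IH (ltnW kn); have := na k.+1 kn; rewrite /= -leNgt => H.
  split; first by apply: le_lt_trans H1.
  move=> m; rewrite leq_eqVlt => /orP[/eqP ->|] //.
  by rewrite ltnS => /H2; apply: le_trans.
have neg x : x \in s -> x = - (absz x)%:Z.
  move=> /(nthP 0) [k ks <-]; rewrite sz in ks; have [H _] := mono k ks.
  by rewrite abszE ltr0_norm ?opprK.
have sE : s = [seq - x%:Z | x : nat <- [seq absz x | x <- s]].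
  rewrite -map_comp -[LHS]map_id; apply/eq_in_map => x /neg /= <- //.
suff E : [seq absz x | x <- s] = iota 1 n.
  by rewrite sE E (iotaDl 1 0) -map_comp; apply: eq_map.
apply: (sorted_eq leq_trans anti_leq) => //; last exact: iota_sorted.
apply/(sortedP 0%N) => k; rewrite size_map => ks.
rewrite !(nth_map 0) //; last by apply: ltnW.
rewrite sz in ks; have [H1 /(_ k (leqnSn _)) H2] := mono _ ks.
have [H0 _] := mono k (ltnW ks).
by rewrite -lez_nat !abszE !ltr0_norm // lerN2.
Qed.

Lemma min_word s : signed_seq s ->
  exists w, [/\ letters w, state w = s & size w = colen s].
Proof.
have [m] := ubnP (colen s); elim: m s => // m IH s ms gs.
have sz := size_signed_seq gs.
case: (pickP (fun i : 'I_n => ascent i s)) => [i asc|na]; last first.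
  have -> : s = state0.
    by apply: no_ascent => // i iN; have := na (Ordinal iN) => /= ->.
  by exists [::]; rewrite colen_state0.
have is1 : (i < size s)%N by rewrite sz.
have [|w [lw sw zw]] := IH (sgact i s) _ (signed_seq_act i gs).
  by rewrite -ltnS (colen_act is1 asc).
exists (val i :: w); split => /=; first by rewrite ltn_ord.
- by rewrite sw sgactK.
- by rewrite zw colen_act.
Qed.

Section Matsumoto.
Variables (X : Type) (op : nat -> X -> X).
Hypothesis op_far : forall i j x, (i < n)%N -> (j < n)%N -> far i j ->
  op i (op j x) = op j (op i x).
Hypothesis op_braid : forall i x, (i.+2 < n)%N ->
  op i.+1 (op i.+2 (op i.+1 x)) = op i.+2 (op i.+1 (op i.+2 x)).
Hypothesis op_braid0 : forall x, (1 < n)%N ->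
  op 0 (op 1 (op 0 (op 1 x))) = op 1 (op 0 (op 1 (op 0 x))).

Lemma ascent_down i t : (i < n)%N -> signed_seq t -> ascent i t ->
  signed_seq (sgact i t) /\ (colen (sgact i t)).+1 = colen t.
Proof.
move=> iN gt ai; split; first exact: signed_seq_act.
by rewrite colen_act ?(size_signed_seq gt).
Qed.

Arguments sgact : simpl never.
Arguments ascent : simpl never.

Lemma ascent0 s : ascent 0 s = (0 < s`_0). Proof. by []. Qed.

Lemma ascentS i s : ascent i.+1 s = (s`_i < s`_i.+1). Proof. by []. Qed.

(** Both sides of the braid relation of two ascents lead from [s], by ascents, to
    the same sequence, and hence extend to reduced words. *)
Lemma dihedral i j s x : (i < n)%N -> (j < n)%N -> i != j -> signed_seq s ->
  ascent i s -> ascent j s ->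
  exists a b, [/\ letters a /\ letters b, state a = sgact i s, state b = sgact j s,
    (size a).+1 = colen s /\ (size b).+1 = colen s &
    op i (foldr op x a) = op j (foldr op x b)].
Proof.
wlog: i j / (i < j)%N.
  move=> W iN jN ij gs ai aj; have [lt|lt|E] := ltngtP i j; first exact: W.
    have ji : j != i by rewrite eq_sym.
    have [a [b [[la lb] sa sb [za zb] E]]] := W j i lt jN iN ji gs aj ai.
    by exists b, a; split.
  by rewrite E eqxx in ij.
move=> lt iN jN _ gs ai aj; have sz := size_signed_seq gs.
have [ij|] := boolP (far i j).
  have [g1 c1] := ascent_down iN gs ai.
  have aj1 : ascent j (sgact i s).
    move: ij aj {ai g1 c1}; rewrite /far; case: j lt jN => // j lt jN ij.
    rewrite ?ascent0 ?ascentS; case: i {lt} ij iN => [|i] ij iN.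
      by rewrite !nth_act0 ifN //; lia.
    by rewrite !nth_actS ?sz // !ifN //; lia.
  have [g2 c2] := ascent_down jN g1 aj1.
  have [c [lc sc zc]] := min_word g2.
  exists (j :: c), (i :: c); split=> /=.
  - by rewrite iN jN.
  - by rewrite sc sgactK // size_act sz.
  - by rewrite sc act_far ?sgactK ?size_act ?sz // farC.
  - by rewrite zc c2 c1.
  - exact: op_far.
rewrite /far negb_or -!leqNgt => /andP[ji _].
have {ji lt} jE : j = i.+1 by lia.
subst j; case: i iN jN ai aj => [|i] iN jN ai aj.
  have [g1 c1] := ascent_down iN gs ai.
  have [|g2 c2] := ascent_down jN g1.
    by move: ai aj; rewrite ?ascent0 ?ascentS !nth_act0 /=; lia.
  have [|g3 c3] := ascent_down iN g2.
    by move: ai aj; rewrite ?ascent0 ?ascentS !nth_actS ?size_act ?sz // nth_act0 /=; lia.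
  have [|g4 c4] := ascent_down jN g3.
    move: ai aj; rewrite ?ascent0 ?ascentS !nth_act0 /= !nth_actS ?size_act ?sz //.
    by rewrite !nth_act0 /=; lia.
  have [c [lc sc zc]] := min_word g4.
  exists [:: 1%N, 0%N, 1%N & c], [:: 0%N, 1%N, 0%N & c]; split=> /=.
  - by rewrite iN jN.
  - by rewrite sc !sgactK ?size_act ?sz.
  - by rewrite sc act_braid0 ?size_act ?sz // !sgactK ?size_act ?sz.
  - by rewrite zc c4 c3 c2 c1.
  - exact: op_braid0.
have [g1 c1] := ascent_down iN gs ai.
have [|g2 c2] := ascent_down jN g1.
  move: ai aj; rewrite ?ascent0 ?ascentS !nth_actS ?sz //.
  by do !case: eqP; intros; (lia || (exfalso; lia)).
have [|g3 c3] := ascent_down iN g2.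
  move: ai aj; rewrite ?ascent0 ?ascentS !nth_actS ?size_act ?sz //.
  by do !case: eqP; intros; (lia || (exfalso; lia)).
have [c [lc sc zc]] := min_word g3.
exists [:: i.+2, i.+1 & c], [:: i.+1, i.+2 & c]; split=> /=.
- by rewrite iN jN.
- by rewrite sc !sgactK ?size_act ?sz.
- by rewrite sc act_braid ?size_act ?sz // !sgactK ?size_act ?sz.
- by rewrite zc c3 c2 c1.
- exact: op_braid.
Qed.

(** Matsumoto's theorem for the hyperoctahedral group: the first letters of two
    reduced words are ascents, and by induction the words can be replaced by
    words that begin with the two sides of a braid relation. *)
Lemma matsumoto x w1 w2 : letters w1 -> letters w2 -> state w1 = state w2 ->
  size w1 = colen (state w1) -> size w2 = colen (state w1) ->
  foldr op x w1 = foldr op x w2.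
Proof.
have [m] := ubnP (size w1); elim: m w1 w2 => // m IH.
case=> [|i a] [|j b] //=.
- by move=> _ _ _ _ /= <-.
- by move=> _ _ _ _ /= <-.
rewrite ltnS => am /andP[iN la] /andP[jN lb] sE za zb.
set s := sgact i (state a) in sE za zb.
have gs : signed_seq s by apply/signed_seq_act/signed_seq_state.
have sz : size s = n := size_signed_seq gs.
have sa : state a = sgact i s by rewrite sgactK // size_state.
have sb : state b = sgact j s by rewrite sE sgactK // size_state.
have asc k c : (k < n)%N -> letters c -> (size c).+1 = colen s ->
    state c = sgact k s -> ascent k s.
  move=> kN lc zc sc; apply: contraT => /leq_colen_act; rewrite sz => /(_ kN).
  by rewrite -sc -zc => H; have := leq_ltn_trans (colen_state lc) H; rewrite ltnn.
have ai := asc i a iN la za sa.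
have aj := asc j b jN lb zb sb.
have [ij|ij] := eqVneq i j.
  subst j; congr op; apply: IH => //; first by rewrite sa sb.
    by apply: succn_inj; rewrite za sa colen_act ?sz.
  by apply: succn_inj; rewrite zb sa colen_act ?sz.
have [a' [b' [[la' lb'] sa' sb' [za' zb'] E]]] := dihedral x iN jN ij gs ai aj.
have sab : size a = size b by lia.
have -> : foldr op x a = foldr op x a'.
  apply: IH => //; first by rewrite sa sa'.
    by apply: succn_inj; rewrite za sa colen_act ?sz.
  by apply: succn_inj; rewrite za' sa colen_act ?sz.
rewrite E; congr op; symmetry; apply: IH => //; first by rewrite -sab.
- by rewrite sb sb'.
- by apply: succn_inj; rewrite zb sb colen_act ?sz.
- by apply: succn_inj; rewrite zb' sb colen_act ?sz.
Qed.

End Matsumoto.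
End States.
End SignedSequences.

(** * Divided differences along reduced words *)

Section SignedDividedDifferences.
Variables (R : idomainType) (n : nat) (D : ddsystem R n).
Implicit Types (f : R) (i j : nat) (w : seq nat).

Definition dd' i f : R := if i == 0%N then dds_d D i f else - dds_d D i f.

Lemma ddN i f : dds_d D i (- f) = - dds_d D i f.
Proof. exact: raddfN. Qed.

Lemma dd'_far i j f : far i j -> dd' i (dd' j f) = dd' j (dd' i f).
Proof.
by move=> ij; rewrite /dd'; do 2!case: ifP => _; rewrite ?ddN dd_far.
Qed.

Lemma foldr_dd' w1 w2 f : letters n w1 -> letters n w2 -> state n w1 = state n w2 ->
  size w1 = colen (state n w1) -> size w2 = colen (state n w1) ->
  foldr dd' f w1 = foldr dd' f w2.
Proof.
apply: matsumoto.
- by move=> i j x _ _; apply: dd'_far.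
- by move=> i x iN; rewrite /dd' /= !ddN ?opprK dd_braid.
- by move=> x nN; rewrite /dd' /= !ddN ?opprK dd_braid0.
Qed.

End SignedDividedDifferences.

Section OneLine.
Variable n : nat.
Implicit Types (v u : signed_perm n) (o : 'I_n).

Definition oneline v : seq int :=
  [seq (-1) ^+ v.2 o * (v.1 o).+1%:Z | o <- enum 'I_n].

Lemma size_oneline v : size (oneline v) = n.
Proof. by rewrite size_map size_enum_ord. Qed.

Lemma nth_oneline v o : (oneline v)`_o = (-1) ^+ v.2 o * (v.1 o).+1%:Z.
Proof. by rewrite (nth_map o) ?size_enum_ord // nth_ord_enum. Qed.

Lemma oneline_inj : injective oneline.
Proof.
move=> v u E; have nE o : v.2 o = u.2 o /\ v.1 o = u.1 o.
  have := nth_oneline v o; rewrite E nth_oneline.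
  case: (u.2 o); case: (v.2 o); rewrite ?expr0 ?expr1; try (move=> *; lia).
    by move=> H; split=> //; apply: val_inj; move: H => /=; lia.
  by move=> H; split=> //; apply: val_inj; move: H => /=; lia.
case: v u nE {E} => [p e] [q e'] /= nE; congr (_, _).
  by apply/permP=> o; case: (nE o).
by apply/ffunP=> o; case: (nE o).
Qed.

Lemma oneline_simple v o : oneline (v * simple_refl o)%g = sgact o (oneline v).
Proof.
apply: (@eq_from_nth _ 0); rewrite ?size_act !size_oneline // => k kn.
suff H (k' : 'I_n) : (oneline (v * simple_refl o)%g)`_k' = (sgact o (oneline v))`_k'.
  exact: (H (Ordinal kn)).
rewrite nth_oneline {k kn}.
have mE u : (v * u)%g = signed_mul v u by [].
rewrite mE /simple_refl; case: (posnP o) => [o0|o0].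
  rewrite /= !ffunE /= mul1g perm1 o0 nth_act0.
  have -> : (k' == o) = (k' == 0%N :> nat) by rewrite -val_eqE /= o0.
  case: eqP => [E|E]; last by rewrite nth_oneline addFb.
  rewrite -[X in _`_X]E.
  by rewrite nth_oneline addTb signrN mulNr.
rewrite /= !ffunE permM.
have oE : nat_of_ord o = o.-1.+1 by rewrite prednK.
rewrite addFb oE nth_actS ?size_oneline -?oE //.
case: tpermP => [->|->|/eqP H1 /eqP H2] /=.
- by rewrite eqxx nth_oneline.
- by rewrite eqxx gtn_eqF ?prednK //= -[o.-1]/(val (prev_ord o)) nth_oneline.
- by rewrite !ifN ?nth_oneline // ?oE.
Qed.

Lemma oneline_longest : oneline (longest n) = state0 n.
Proof.
rewrite /oneline /state0 -val_enum_ord -map_comp; apply: eq_map => o /=.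
by rewrite ffunE perm1 expr1 mulN1r.
Qed.

Lemma simple_reflV o : ((simple_refl o)^-1 = simple_refl o)%g.
Proof.
apply/eqP; rewrite eq_invg_mul; apply/eqP/oneline_inj.
rewrite -[X in oneline X]mul1g mulgA !oneline_simple sgactK // size_oneline.
by rewrite ltn_ord.
Qed.

Lemma state_word (a : seq 'I_n) :
  state n [seq val o | o <- a] = oneline (longest n * (word_prod a)^-1)%g.
Proof.
elim: a => [|o a IH]; first by rewrite /word_prod big_nil invg1 mulg1 oneline_longest.
rewrite /word_prod big_cons invMg mulgA simple_reflV oneline_simple /=.
by rewrite -/(word_prod a) -IH.
Qed.

Lemma letters_ord w : letters n w -> exists a : seq 'I_n, w = [seq val o | o <- a].
Proof.
elim: w => [|i w IH]; first by exists [::].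
by case/andP=> iN /IH[a ->]; exists (Ordinal iN :: a).
Qed.

Lemma letters_val (a : seq 'I_n) : letters n [seq val o | o <- a].
Proof. by apply/allP=> i /mapP[o _ ->]; apply: ltn_ord. Qed.

(** A shortest word has length [colen] since there is a word of that length. *)
Lemma size_reduced_word v a : reduced_word a (v^-1 * longest n)%g ->
  state n [seq val o | o <- a] = oneline v /\ size a = colen (oneline v).
Proof.
case/andP=> /eqP aw /forallP amin.
have sa : state n [seq val o | o <- a] = oneline v.
  by rewrite state_word aw invMg invgK mulgA mulgV mul1g.
split=> //; apply/eqP; rewrite eqn_leq -{2}sa -(size_map val) colen_state ?letters_val //.
rewrite andbT leqNgt; apply/negP => lt.
have gs : signed_seq n (oneline v) by rewrite -sa signed_seq_state.
have [w [lw sw zw]] := min_word gs; have [b bE] := letters_ord lw.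
rewrite size_map in lt.
have zb : size b = colen (oneline v) by rewrite -zw bE size_map.
have /forallP/(_ (in_tuple b)) :
    [forall b : (size b).-tuple 'I_n, word_prod b != (v^-1 * longest n)%g].
  by have lt' : (size b < size a)%N by [rewrite zb]; have := amin (Ordinal lt').
case/eqP; apply: invg_inj; apply: (mulgI (longest n)); apply: oneline_inj.
by rewrite -state_word -bE sw invMg invgK mulgA mulgV mul1g.
Qed.

(** By Matsumoto's theorem the word chosen in the definition of [ddiff'_perm] can
    be replaced by any word of length [colen]. *)
Lemma ddiff'_permE (K : idomainType) v (f : {mpoly K[n]}) w :
  letters n w -> state n w = oneline v -> size w = colen (oneline v) ->
  ddiff'_perm (v^-1 * longest n)%g f = foldr (dd' (mpoly_ddsystem K n)) f w.
Proof.
move=> lw sw zw; rewrite /ddiff'_perm.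
have := xchooseP (reduced_word_ex (v^-1 * longest n)%g).
set a := xchoose _ => /size_reduced_word[sa za].
rewrite -(foldr_dd' (mpoly_ddsystem K n) (w1 := [seq val o | o <- a])) ?letters_val //.
- elim: (a) => [|o b IH]; first by [].
  by rewrite [RHS]/= -IH /dd' [LHS]/= /ddiff' -ddn_ord.
- by rewrite sa sw.
- by rewrite size_map sa.
- by rewrite sa.
Qed.

End OneLine.

(** * Rows of divided differences and staircases *)

Section Staircase.
Variables (R : idomainType) (n : nat) (D : ddsystem R n).
Implicit Types (f g h : R) (i j k d m q : nat).
Local Notation xv := (dds_x D).
Local Notation sa := (dds_s D).
Local Notation dd := (dds_d D).

(** The composite of the divided differences of indices [k.+1], ..., [k + d], in
    this order; it acts on the variables of indices [k], ..., [k + d]. *)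
Fixpoint ddrow k d f : R := if d is d'.+1 then ddrow k.+1 d' (dd k.+1 f) else f.

Lemma ddrow_is_additive k d : {morph ddrow k d : f g / f + g}.
Proof. by elim: d k => [|d IH] k f g //=; rewrite ddD IH. Qed.

Lemma ddrow0 k d : ddrow k d 0 = 0.
Proof. by elim: d k => [|d IH] k //=; rewrite dd0 IH. Qed.

HB.instance Definition _ k d :=
  GRing.isNmodMorphism.Build R R (ddrow k d) (conj (ddrow0 k d) (@ddrow_is_additive k d)).

Lemma ddrowN k d f : ddrow k d (- f) = - ddrow k d f.
Proof. exact: raddfN. Qed.

Lemma ddrow_invl k d f g : (forall i, (k < i <= k + d)%N -> sa i f = f) ->
  ddrow k d (f * g) = f * ddrow k d g.
Proof.
elim: d k g => [|d IH] k g fi //=; rewrite dd_invl; last by apply: fi; lia.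
by apply: IH => i ki; apply: fi; lia.
Qed.

Section Phi.
Variable y : nat -> R.
Hypothesis y_inv : forall i j, sa i (y j) = y j.

Definition phi q (x : R) : R := \prod_(j < q) (x - y j).

Lemma phiS q x : phi q.+1 x = phi q x * (x - y q).
Proof. by rewrite /phi big_ord_recr. Qed.

Lemma sa_phi i q x : sa i (phi q x) = phi q (sa i x).
Proof. by rewrite rmorph_prod; apply: eq_bigr => j _; rewrite rmorphB y_inv. Qed.

(** Each divided difference lowers the degree by one and keeps the leading
    coefficient. *)
Lemma ddrow_phi k d q : (k + d < n)%N -> (q <= d)%N ->
  ddrow k d (phi q (xv k)) = (q == d)%:R.
Proof.
elim: d k q => [|d IH] k q kn.
  by rewrite leqn0 => /eqP ->; rewrite /= /phi big_ord0.
elim: q => [|q IHq] qd.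
  by rewrite /= /phi big_ord0 dd_inv ?ddrow0 // rmorph1.
have kn1 : (k.+1 < n)%N by lia.
have dx : dd k.+1 (xv k - y q) = 1.
  by apply: ddE => //; rewrite rmorphB sa_xvS // eqxx y_inv /dds_den /=; ring.
rewrite phiS /= ddM // dx mulr1 raddfD /= [X in ddrow _ _ X + _]mulrC.
rewrite ddrow_invl; last first.
  by move=> [|i] ki; rewrite // rmorphB y_inv sa_xv_far //; lia.
rewrite -[ddrow k.+1 d (dd _ _)]/(ddrow k d.+1 _) IHq; last by lia.
rewrite (_ : (q == d.+1) = false) ?mulr0 ?add0r; last by lia.
by rewrite sa_phi sa_xvS // eqxx IH ?eqSS //; lia.
Qed.

(** The polynomial [phi m.-1 x_k * phi m.-2 x_(k+1) * ... * phi 0 x_(k+m-1)];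
    for [k = 0] and [m = n] this is the type A double Schubert polynomial of the
    longest permutation. *)
Fixpoint stair k m : R := if m is m'.+1 then phi m' (xv k) * stair k.+1 m' else 1.

Lemma sa_stair i k m : (i < k)%N -> (i < n)%N -> sa i (stair k m) = stair k m.
Proof.
elim: m k => [|m IH] k ik iN /=; first by rewrite rmorph1.
rewrite rmorphM IH //; last by lia.
rewrite sa_phi; congr (phi _ _ * _).
case: i ik iN {IH} => [|i] ik iN; first by rewrite sa_xv0 ifN //; lia.
by rewrite sa_xv_far //; lia.
Qed.

(** Leibniz' rule applied to the product: the term in which every factor of the
    staircase is carried to the preceding variable is the right-hand side, and
    the terms in which a factor is differentiated vanish for degree reasons. *)
Lemma ddrow_stair k d m h : (k + d < n)%N -> (m <= d)%N ->
  (forall i, (k.+1 < i <= k + d)%N -> sa i h = h) ->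
  ddrow k d (stair k.+1 m * h) = stair k m * ddrow k d h.
Proof.
elim: d k m h => [|d IH] k [|m] h kn // md hi; rewrite ?mul1r //.
have kn1 : (k.+1 < n)%N by lia.
have dxk1 i : (k.+2 < i <= k.+1 + d)%N -> far i k.+1 by rewrite /far; lia.
have sxk i : (k.+1 < i <= k.+1 + d)%N -> sa i (phi m (xv k)) = phi m (xv k).
  by case: i => // i ki; rewrite sa_phi sa_xv_far //; lia.
rewrite [LHS]/= [phi _ _ * _ * _]mulrAC [X in ddrow _ _ (dd _ X)]mulrC.
rewrite dd_invl; last by apply: sa_stair; lia.
rewrite ddM // sa_phi sa_xvS // eqxx (gtn_eqF (ltnSn k)) mulrDr raddfD /=.
set p := dd k.+1 (phi m (xv k.+1)).
(* By induction the remaining staircase can be pulled out; the degree of [p] is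
   less than the number of the remaining differences. *)
have -> : ddrow k.+1 d (stair k.+2 m * (p * h)) = 0.
  rewrite mulrCA -[p * _]mulrC [stair _ _ * _]mulrC -mulrA ddrow_invl; last first.
    by move=> i ki; apply: hi; lia.
  rewrite IH; last 3 first; [by lia | by lia | |].
    move=> i ki; rewrite /p sa_dd_far ?dxk1 //; last by lia.
    case: i ki => // i ki; rewrite sa_phi sa_xv_far //; lia.
  have -> : p = - dd k.+1 (phi m (xv k)).
    apply: ddE => //; rewrite mulNr ddP // !sa_phi !sa_xvS // !eqxx.
    by rewrite (gtn_eqF (ltnSn k)); ring.
  rewrite ddrowN -[ddrow k.+1 d _]/(ddrow k d.+1 _) ddrow_phi //; last by lia.
  by rewrite (_ : (m == d.+1) = false) ?oppr0 ?mulr0 //; lia.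
rewrite add0r mulrCA ddrow_invl // IH; last 3 first; [by lia | by lia | |].
  move=> i ki; rewrite sa_dd_far ?dxk1 // ?hi //; lia.
by rewrite mulrA.
Qed.

End Phi.
End Staircase.

(** * The path to a Grassmannian signed permutation *)

Section Path.
Variables (R : idomainType) (n : nat) (D : ddsystem R n) (f0 : R).
Implicit Types (f g h : R) (i j k d m q r : nat) (s t : seq int).
Local Notation xv := (dds_x D).
Local Notation sa := (dds_s D).
Local Notation dd := (dds_d D).

(** Up to a sign and for a suitable [f0], [f] is the double Schubert polynomial of
    the signed permutation with one-line notation [s]. *)
Definition reach s f :=
  exists w, [/\ letters n w, state n w = s, size w = colen s & foldr (dd' D) f0 w = f].

Lemma reach0 : reach (state0 n) f0.
Proof. by exists [::]; rewrite colen_state0. Qed.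

Lemma reach_step i s f : reach s f -> (i < n)%N -> ascent i (sgact i s) ->
  reach (sgact i s) (dd' D i f).
Proof.
move=> [w [lw sw zw fw]] iN asc; exists (i :: w); split=> /=.
- by rewrite iN.
- by rewrite sw.
- have sz : size s = n by rewrite -sw size_state.
  by rewrite zw -(colen_act _ asc) ?size_act ?sz // sgactK ?sz.
- by rewrite fw.
Qed.

Lemma swapseq_cat s (a b : int) t : swapseq (size s) (s ++ [:: a, b & t]) = s ++ [:: b, a & t].
Proof. by elim: s => //= c s ->. Qed.

(** An entry larger than the following ones can be moved to their right. *)
Lemma reach_move s (a : int) t u f : reach (s ++ a :: t ++ u) f -> all (fun b => b < a) t ->
  reach (s ++ t ++ a :: u) ((-1) ^+ size t * ddrow D (size s) (size t) f).
Proof.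
elim: t s f => [|b t IH] s f rf /=; first by rewrite expr0 mul1r.
case/andP=> ba ta.
have sz : size (s ++ [:: a, b & t ++ u]) = n.
  by case: rf => w [_ <- _ _]; rewrite size_state.
have actE : sgact (size s).+1 (s ++ [:: a, b & t ++ u]) = s ++ [:: b, a & t ++ u].
  exact: swapseq_cat.
have iN : ((size s).+1 < n)%N by rewrite -sz size_cat /=; lia.
have asc : ascent (size s).+1 (sgact (size s).+1 (s ++ [:: a, b & t ++ u])).
  rewrite actE ascentS !nth_cat ltnn subnn (ltnNge (size s).+1) leqnSn.
  by rewrite subSn // subnn.
have H := reach_step rf iN asc.
rewrite actE /dd' /= in H.
have := IH (rcons s b) (- dd (size s).+1 f).
rewrite -!cats1 -!catA /= size_cat addn1 => /(_ H ta).
by rewrite ddrowN exprS mulN1r mulrN mulNr.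
Qed.

Variables (y : nat -> R) (p : pred nat) (G : nat -> R).
Hypothesis y_inv : forall i j, sa i (y j) = y j.

(** The one-line notations along the path: the values [r.+1], ..., [n] are still
    to be processed; a processed value [i.+1] ends barred if [p i]. *)
Definition path_tail r : seq int :=
  [seq - (i.+1)%:Z | i <- rev [seq i <- iota 0 r | p i]] ++
  [seq (i.+1)%:Z | i <- iota 0 r & ~~ p i].
Definition path_state r : seq int :=
  [seq - (i.+1)%:Z | i <- iota r (n - r)] ++ path_tail r.

(** The operator of the word [s_(n-1) ... s_1 s_0]; the sign is the one between
    [dd'] and [dds_d]. *)
Definition nabla f : R := (-1) ^+ n.-1 * ddrow D 0 n.-1 (dd 0 f).

Hypothesis G_sym : forall r i, (0 < i < n)%N -> sa i (G r) = G r.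
Hypothesis G_step : forall r, (r < n)%N ->
  G r.+1 = if p r then G r else nabla (phi y (n - r).-1 (xv 0) * G r).
Hypothesis f0E : f0 = stair D y 0 n * G 0.

Lemma path_tailS r : path_tail r.+1 =
  if p r then - (r.+1)%:Z :: path_tail r else rcons (path_tail r) (r.+1)%:Z.
Proof.
have iE : iota 0 r.+1 = iota 0 r ++ [:: r] by rewrite -addn1 iotaD.
rewrite /path_tail iE !filter_cat /=; case: (p r); first by rewrite /= cats0 rev_cat.
by rewrite /= cats0 map_cat catA cats1.
Qed.

Lemma size_path_tail r : size (path_tail r) = r.
Proof. by elim: r => // r IH; rewrite path_tailS; case: ifP; rewrite /= ?size_rcons IH. Qed.

Lemma path_tail_lt r : all (fun b : int => b < r.+1%:Z) (path_tail r).
Proof.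
elim: r => // r IH; rewrite path_tailS.
have IH' : all (fun b : int => b < r.+2%:Z) (path_tail r).
  by apply: sub_all IH => b; lia.
by case: ifP => _; rewrite /= ?all_rcons IH'; lia.
Qed.

(** The smallest value still to be processed comes first.  If it stays barred, it
    moves to the right of the other unprocessed values; if not, it loses its bar
    and moves to the end.  By [ddrow_stair] the staircase gets shorter by one in
    both cases, and its first factor is left to act on [G]. *)
Lemma reach_path r : (r <= n)%N ->
  reach (path_state r)
    ((\prod_(i < r | p i) (-1) ^+ (n - i).-1) * (stair D y 0 (n - r) * G r)).
Proof.
elim: r => [|r IH] rn.
  by rewrite /path_state subn0 cats0 big_ord0 mul1r -f0E; apply: reach0.
have {}IH := IH (ltnW rn).
set sg := \prod_(i < r | p i) _ in IH.
have nr : (n - r = (n - r.+1).+1)%N by lia.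
set m := (n - r.+1)%N in nr *.
have stateE : path_state r =
    - (r.+1)%:Z :: [seq - (i.+1)%:Z | i <- iota r.+1 m] ++ path_tail r.
  by rewrite /path_state nr.
set rest := [seq _ | i <- iota r.+1 m] in stateE.
have zrest : size rest = m by rewrite size_map size_iota.
have rest_lt : all (fun b : int => b < - (r.+1)%:Z) rest.
  by apply/allP=> b /mapP[i]; rewrite mem_iota => ri ->; lia.
have sgi i : sa i sg = sg.
  rewrite rmorph_prod; apply: eq_bigr => j _; by rewrite rmorphXn rmorphN1.
rewrite stateE nr in IH.
have sgE : \prod_(i < r.+1 | p i) (-1) ^+ (n - i).-1 =
    (if p r then sg * (-1) ^+ m else sg) :> R.
  by rewrite big_mkcond big_ord_recr /= -big_mkcond /= nr; case: (p r); rewrite ?mulr1.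
rewrite sgE (G_step rn) /path_state -/m -/rest path_tailS nr /=.
(* The value [r.+1] stays barred. *)
case: (p r).
  have := reach_move (s := [::]) (t := rest) IH rest_lt.
  rewrite /= zrest ddrow_invl //.
  have -> : ddrow D 0 m (phi y m (xv 0) * stair D y 1 m * G r) =
      stair D y 0 m * G r.
    rewrite mulrAC mulrC ddrow_stair //; try lia.
      rewrite [phi _ _ _ * _]mulrC ddrow_invl; last by move=> i im; apply: G_sym; lia.
      by rewrite ddrow_phi ?eqxx ?mulr1 //; lia.
    move=> [|i] im //; rewrite rmorphM G_sym ?sa_phi ?sa_xv_far //; lia.
  by rewrite mulrCA mulrA.
(* The value [r.+1] loses its bar. *)
have n0 : (0 < n)%N by lia.
have := reach_step (i := 0) IH n0; rewrite ascent0 nth_act0 /= /sgact opprK => /(_ isT) H.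
have := reach_move (s := [::]) (t := rest ++ path_tail r) (u := [::]) _ _.
rewrite cats0 => /(_ _ _ H); rewrite all_cat path_tail_lt andbT.
have rest_lt' : all (fun b : int => b < (r.+1)%:Z) rest.
  by apply: sub_all rest_lt => b; lia.
move=> /(_ rest_lt'); rewrite /= cats1 rcons_cat.
rewrite size_cat zrest size_path_tail (_ : (m + r)%N = n.-1); last by lia.
rewrite /dd' /= dd_invl // ddrow_invl //.
have -> : dd 0 (phi y m (xv 0) * stair D y 1 m * G r) =
    stair D y 1 m * dd 0 (phi y m (xv 0) * G r).
  by rewrite [_ * stair _ _ _ _]mulrC -mulrA dd_invl // sa_stair.
rewrite ddrow_stair //; try lia.
  by rewrite /nabla mulrCA; congr (reach _ (_ * _)); rewrite mulrCA.
move=> [|i] im //; rewrite sa_dd_far //; try lia.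
  rewrite rmorphM G_sym ?sa_phi ?sa_xv_far //; lia.
by rewrite /far; lia.
Qed.

End Path.

(** * Elementary symmetric polynomials *)

Section ElementarySymmetric.
Variable A : comUnitRingType.
Implicit Types (v : seq A) (x : A) (i : int) (k d : nat).

Definition genpoly v : {poly A} := \prod_(x <- v) (1 + x *: 'X).

Lemma elemsym_coef v k : elemsym v k%:Z = (genpoly v)`_k.
Proof.
rewrite /elemsym /genpoly (big_nth 0) big_mkord.
under eq_bigr => i _ do rewrite addrC.
rewrite bigA_distr coef_sum /mesym raddf_sum /= big_mkcond /=.
apply: eq_bigr => h _.
rewrite -big_mkcond /=.
rewrite scaler_prod prodr_const coefZ coefXn rmorph_prod /= eq_sym.
rewrite (eq_bigr (fun i : 'I_(size v) => v`_i)); last by move=> i _; rewrite mevalXU.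
by case: eqP => _; rewrite ?mulr1 ?mulr0.
Qed.

Global Arguments elemsym : simpl never.

Lemma elemsym0 v : elemsym v 0%:Z = 1.
Proof.
rewrite elemsym_coef /genpoly -horner_coef0 horner_prod big1 // => x _.
by rewrite !hornerE.
Qed.

Lemma elemsym_lt0 v i : i < 0 -> elemsym v i = 0.
Proof. by case: i. Qed.

Lemma elemsym_gt v i : (size v)%:Z < i -> elemsym v i = 0.
Proof. by case: i => // k; rewrite ltz_nat => kv; rewrite /elemsym mesym_geqnE // rmorph0. Qed.

Lemma perm_elemsym u v i : perm_eq u v -> elemsym u i = elemsym v i.
Proof. by case: i => // k uv; rewrite !elemsym_coef /genpoly (perm_big _ uv). Qed.

Lemma elemsym_cons x v i : elemsym (x :: v) i = elemsym v i + x * elemsym v (i - 1).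
Proof.
case: i => [[|k]|k]; last by rewrite !elemsym_lt0 ?mulr0 ?addr0 //; lia.
  by rewrite !elemsym0 sub0r mulr0 addr0.
rewrite (_ : k.+1%:Z - 1 = k%:Z); last by lia.
rewrite !elemsym_coef /genpoly big_cons mulrDl mul1r coefD -scalerAl coefZ.
by rewrite coefXM.
Qed.

Lemma elemsym_rcons x v i : elemsym (rcons v x) i = elemsym v i + x * elemsym v (i - 1).
Proof. by rewrite (@perm_elemsym _ (x :: v)) ?elemsym_cons // perm_rcons. Qed.

(** Vieta's formula. *)
Lemma prod_elemsym (y : nat -> A) x d :
  \prod_(j < d) (x - y j) =
  \sum_(k < d.+1) (-1) ^+ k * elemsym (mkseq y d) k%:Z * x ^+ (d - k).
Proof.
elim: d => [|d IH]; first by rewrite big_ord0 big_ord1 elemsym0 !mulr1.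
rewrite big_ord_recr /= IH mulrBr mulr_suml.
rewrite [RHS](eq_bigr (fun k : 'I_d.+2 => (-1) ^+ k * elemsym (mkseq y d) k * x ^+ (d.+1 - k)
  + (-1) ^+ k * (y d * elemsym (mkseq y d) (k%:Z - 1)) * x ^+ (d.+1 - k))); last first.
  by move=> k _; rewrite mkseqS elemsym_rcons mulrDr mulrDl.
rewrite [RHS]big_split /= [X in _ = X + _]big_ord_recr /= elemsym_gt ?size_mkseq ?ltz_nat //.
rewrite mulr0 mul0r addr0 [X in _ = _ + X]big_ord_recl /= elemsym_lt0 // mulr0 mulr0 mul0r add0r.
congr (_ + _).
  apply: eq_bigr => k _; rewrite -!mulrA -exprSr subSn //.
  by rewrite -ltnS ltn_ord.
rewrite mulr_suml -sumrN; apply: eq_bigr => k _.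
rewrite /bump /= add1n subSS (_ : k.+1%:Z - 1 = k%:Z); last by lia.
by rewrite exprS; ring.
Qed.

End ElementarySymmetric.

Lemma rmorph_elemsym (A B : comUnitRingType) (h : {rmorphism A -> B}) (v : seq A)
    (i : int) :
  h (elemsym v i) = elemsym (map h v) i.
Proof.
elim: v i => [|x v IH] i /=; last by rewrite !elemsym_cons rmorphD rmorphM !IH.
case: i => [[|k]|k]; rewrite ?elemsym0 ?rmorph1 //.
  by rewrite !elemsym_gt ?rmorph0.
by rewrite !elemsym_lt0 ?rmorph0.
Qed.

(** * Divided differences of Pfaffians *)

Section Annihilation.
Variables (R : idomainType) (n : nat) (D : ddsystem R n).
Implicit Types (f g h : R) (i j k d m q r : nat).
Local Notation xv := (dds_x D).
Local Notation sa := (dds_s D).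
Local Notation dd := (dds_d D).
Local Notation ddrow := (ddrow D).
Local Notation nabla := (nabla D).
Hypothesis n_gt0 : (0 < n)%N.

Definition vars : seq R := mkseq xv n.
Definition vars' : seq R := [seq xv j | j <- iota 1 n.-1].

Lemma vars_cons : vars = xv 0 :: vars'.
Proof.
have iE : iota 0 n = 0%N :: iota 1 n.-1 by case: (n) n_gt0.
by rewrite /vars /mkseq iE.
Qed.

Lemma size_vars' : size vars' = n.-1.
Proof. by rewrite size_map size_iota. Qed.

Lemma perm_sa_range i a m : (i.+1 < n)%N -> (a <= i)%N -> (i.+1 < a + m)%N ->
  perm_eq [seq sa i.+1 (xv j) | j <- iota a m] [seq xv j | j <- iota a m].
Proof.
move=> iN ai im.
pose t j := if j == i then i.+1 else if j == i.+1 then i else j.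
have tK : involutive t by move=> j; rewrite /t; do !case: eqP => //; lia.
rewrite (eq_map (f := fun j => sa i.+1 (xv j)) (g := xv \o t)); last first.
  by move=> j; rewrite sa_xvS.
rewrite map_comp; apply: perm_map; apply: uniq_perm; rewrite ?iota_uniq //.
  by rewrite map_inj_uniq ?iota_uniq //; apply: inv_inj.
move=> j; rewrite -[j in LHS]tK (mem_map (inv_inj tK)) !mem_iota /t.
by do !case: eqP => //; lia.
Qed.

Lemma sa_elemsym i (l : int) : (0 < i < n)%N -> sa i (elemsym vars l) = elemsym vars l.
Proof.
case: i => // i iN; rewrite rmorph_elemsym; apply: perm_elemsym.
by rewrite /vars -map_comp; apply: perm_sa_range.
Qed.

Lemma sa0_elemsym' (l : int) : sa 0 (elemsym vars' l) = elemsym vars' l.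
Proof.
rewrite rmorph_elemsym /vars' -map_comp; congr elemsym.
by apply/eq_in_map => j; rewrite mem_iota /= sa_xv0 => /andP[j1 _]; rewrite ifN //; lia.
Qed.

Lemma elemsym_vars (l : int) :
  elemsym vars l = elemsym vars' l + xv 0 * elemsym vars' (l - 1).
Proof. by rewrite vars_cons elemsym_cons. Qed.

Lemma sa0_elemsym (l : int) :
  sa 0 (elemsym vars l) = elemsym vars' l - xv 0 * elemsym vars' (l - 1).
Proof.
by rewrite elemsym_vars rmorphD rmorphM !sa0_elemsym' sa_xv0 mulNr.
Qed.

Let x := xv 0.
Let e (p : nat) : R := elemsym vars p%:Z.
Let e' (p : nat) : R := elemsym vars' (p%:Z - 1).
Let Q (p q : nat) : R := Qtilde2 vars p q.

(** Writing the elementary symmetric polynomials in terms of those of [vars'],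
    the difference of both sides becomes a telescoping sum.  The perturbation has
    rank two, which is what [pfseq_rank2] is for. *)
Lemma sa0_Qtilde2 p q :
  sa 0 (Q p q) = Q p q + ((- 2%:R * x * e' p) * e q - e p * (- 2%:R * x * e' q)).
Proof.
rewrite /Q /Qtilde2 /e /e' rmorphD !rmorphM !sa0_elemsym rmorph_nat rmorph_sum /=.
set E := elemsym vars'.
pose T k := E (p + k)%N%:Z * E (q%:Z - k%:Z - 1).
have S1 m : (m <= q)%N ->
    \sum_(1 <= k < m.+1) sa 0 ((-1) ^+ k * (elemsym vars (p + k)%N * elemsym vars (q - k)%N))
  = \sum_(1 <= k < m.+1) (-1) ^+ k * (elemsym vars (p + k)%N * elemsym vars (q - k)%N)
    - 2%:R * x * ((-1) ^+ m * T m - T 0%N).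
  elim: m => [|m IH] mq.
    by rewrite !big_geq // /T expr0; ring.
  rewrite big_nat_recr //= IH; last by lia.
  rewrite [in RHS]big_nat_recr //= !rmorphM rmorphXn rmorphN1 !sa0_elemsym.
  rewrite !elemsym_vars -/E /T.
  rewrite (_ : (p + m.+1)%N%:Z - 1 = (p + m)%N%:Z); last by lia.
  rewrite (_ : (q - m.+1)%N%:Z = q%:Z - m%:Z - 1); last by lia.
  rewrite (_ : q%:Z - m.+1%:Z - 1 = q%:Z - m%:Z - 1 - 1); last by lia.
  rewrite exprS /x; ring.
rewrite S1 // !elemsym_vars -/E /T subrr sub0r (_ : E (-1) = 0) ?elemsym_lt0 // addn0 subr0.
rewrite /x; ring.
Qed.

Lemma dd0_pfseq m (s : seq nat) : size s = m.+1.*2 ->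
  dd 0 (pfseq Q m.+1 s) = 2%:R * contract e' (contract e (pfseq Q m)) s.
Proof.
move=> sz; apply: ddE => //; rewrite -[dds_den D 0]/x.
rewrite rmorph_pfseq (eq_pfseq _ _ sa0_Qtilde2).
rewrite (pfseq_rank2 Q (fun p => - 2%:R * x * e' p) e sz).
by rewrite contract_scale /x; ring.
Qed.

Lemma sa_Q i p q : (0 < i < n)%N -> sa i (Q p q) = Q p q.
Proof.
move=> iN; rewrite /Q /Qtilde2 rmorphD !rmorphM !sa_elemsym // rmorph_nat rmorph_sum.
congr (_ + _ * _); apply: eq_bigr => k _.
by rewrite !rmorphM !sa_elemsym // rmorphXn rmorphN1.
Qed.

Lemma sa_pfseq i m s : (0 < i < n)%N -> sa i (pfseq Q m s) = pfseq Q m s.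
Proof. by move=> iN; rewrite rmorph_pfseq; apply: eq_pfseq => p q; apply: sa_Q. Qed.

Lemma sa_contract_pfseq i m s : (0 < i < n)%N ->
  sa i (contract e (pfseq Q m) s) = contract e (pfseq Q m) s.
Proof.
move=> iN; rewrite rmorph_contract; apply: eq_contract => [p|u _].
  by rewrite /= sa_elemsym.
by rewrite /= sa_pfseq.
Qed.

Lemma ddrow_sym c g : (forall i, (0 < i < n)%N -> sa i g = g) ->
  ddrow 0 n.-1 (c * g) = g * ddrow 0 n.-1 c.
Proof. by move=> gi; rewrite mulrC ddrow_invl // => i ii; apply: gi; lia. Qed.

Lemma ddrow_pow c : (c <= n.-1)%N -> ddrow 0 n.-1 (x ^+ c) = (c == n.-1)%:R.
Proof.
move=> cn; have y0 i j : sa i ((fun=> 0) j : R) = 0 by rewrite rmorph0.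
have kn : (0 + n.-1 < n)%N by lia.
rewrite -(ddrow_phi y0 kn cn); congr ddrow.
by rewrite /phi prodr_const card_ord subr0.
Qed.

(** The powers of the first variable and the elementary symmetric polynomials in
    the others are biorthogonal.  By [elemsym_vars] and the symmetry of
    [elemsym vars], the values at [(c, p.+1)] and at [(c.+1, p)] add up to a
    multiple of the value of [ddrow_pow] at [c], which is 0 for [c < n.-1].
    Increasing [c] one arrives at [p = 0] and [ddrow_pow]; decreasing it, at an
    elementary symmetric polynomial of degree larger than [n.-1]. *)
Lemma ddrow_pow_elemsym c p : (c <= n.-1)%N ->
  ddrow 0 n.-1 (x ^+ c * elemsym vars' p%:Z) = (-1) ^+ p * (c + p == n.-1)%N%:R.
Proof.
have step d r : (d < n.-1)%N ->
    ddrow 0 n.-1 (x ^+ d * elemsym vars' r.+1%:Z) =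
    - ddrow 0 n.-1 (x ^+ d.+1 * elemsym vars' r%:Z).
  move=> dn; apply/eqP; rewrite -addr_eq0 -raddfD /=.
  rewrite exprSr -mulrA -mulrDr (_ : r%:Z = r.+1%:Z - 1); last by lia.
  rewrite -elemsym_vars ddrow_sym; last by move=> i; apply: sa_elemsym.
  by rewrite ddrow_pow ?ltn_eqF ?mulr0 // ltnW.
move=> cn; have [cp|cp] := leqP (c + p) n.-1.
  elim: p c cn cp => [|p IH] c cn cp.
    by rewrite elemsym0 mulr1 addn0 ddrow_pow // expr0 mul1r.
  rewrite step; last by lia.
  by rewrite IH ?addSnnS ?exprS; [ring | lia | lia].
elim: c p cn cp => [|c IH] p cn cp.
  rewrite elemsym_gt; last by rewrite size_vars'; lia.
  by rewrite mulr0 raddf0 gtn_eqF ?mulr0.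
have := step c p cn; rewrite IH; [|lia|lia].
rewrite (_ : (c + p.+1 == n.-1)%N = false); last by lia.
rewrite (_ : (c.+1 + p == n.-1)%N = false); last by lia.
by rewrite !mulr0 => /eqP; rewrite eq_sym oppr_eq0 => /eqP.
Qed.

Lemma ddrow_contract c F s : (forall u i, (0 < i < n)%N -> sa i (F u) = F u) ->
  ddrow 0 n.-1 (x ^+ c * contract e' F s) =
  contract (fun p => ddrow 0 n.-1 (x ^+ c * e' p)) F s.
Proof.
elim: s F => [|p s IH] F Fi /=; first by rewrite mulr0 raddf0.
rewrite mulrBr raddfB /= IH => [|u i]; last exact: Fi.
rewrite mulrA (ddrow_sym _ (g := F s)) => [|i]; last exact: Fi.
by rewrite [F s * _]mulrC.
Qed.

Lemma dd0_pow c : (c <= n.-1)%N -> ddrow 0 n.-1 (dd 0 (x ^+ c)) = 0.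
Proof.
move=> cn; case oc: (odd c).
  case: c oc cn => // c /= oc cn.
  have -> : dd 0 (x ^+ c.+1) = 2%:R * x ^+ c.
    apply: ddE => //; rewrite /dds_den rmorphXn sa_xv0 -/x [(- x) ^+ _]exprNn.
    by rewrite -signr_odd /= oc expr1 exprS; ring.
  rewrite mulr_natl raddfMn /= ddrow_pow; last by lia.
  by rewrite ltn_eqF // mul0rn.
rewrite dd_inv ?raddf0 // rmorphXn sa_xv0 exprNn -signr_odd oc mul1r //.
Qed.

Lemma nabla_pow c g : (c <= n.-1)%N -> (forall i, (0 < i < n)%N -> sa i g = g) ->
  nabla (x ^+ c * g) = (-1) ^+ (n.-1 + c) * ddrow 0 n.-1 (x ^+ c * dd 0 g).
Proof.
move=> cn gi; rewrite /nabla ddM // raddfD /= ddrow_sym // dd0_pow // mulr0 add0r.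
rewrite rmorphXn (_ : sa 0 x = - x) ?sa_xv0 // [(- x) ^+ c]exprNn.
rewrite -[_ * dd 0 g]mulrA (ddrow_invl (f := (-1) ^+ c)); last first.
  by move=> i _; rewrite rmorphXn rmorphN1.
by rewrite mulrA exprD.
Qed.

(** By [dd0_pfseq] the difference [dd 0] contracts with [e'] and [e]; the other
    differences turn [e'] into the indicator function of [b], by biorthogonality. *)
Lemma nabla_pfseq b m s : (0 < b <= n)%N -> size s = m.+1.*2 ->
  nabla (x ^+ (n - b) * pfseq Q m.+1 s) =
  2%:R * contract (fun p => (p == b)%:R) (contract e (pfseq Q m)) s.
Proof.
move=> bn sz; rewrite nabla_pow; [|lia|by move=> i; apply: sa_pfseq].
rewrite dd0_pfseq // [x ^+ _ * (_ * _)]mulrCA ddrow_invl => [|i _]; last by rewrite rmorph_nat.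
rewrite ddrow_contract; last first.
  by move=> u i; apply: sa_contract_pfseq.
rewrite (eq_contract (a := fun p => ddrow 0 n.-1 (x ^+ (n - b) * e' p))
  (b := fun p => (-1) ^+ b.-1 * (p == b)%:R)
  (G := contract e (pfseq Q m))) //.
  rewrite contract_scale; set c := contract _ _ s.
  transitivity ((-1) ^+ (n.-1 + (n - b) + b.-1) * (2%:R * c)).
    by rewrite [in RHS]exprD; ring.
  rewrite -signr_odd (_ : odd _ = false); last by lia.
  by rewrite expr0 mul1r.
move=> [|p]; rewrite /e'.
  rewrite elemsym_lt0 // mulr0 raddf0 (_ : (0 == b)%N = false); last by lia.
  by rewrite mulr0.
rewrite (_ : p.+1%:Z - 1 = p%:Z); last by lia.
rewrite ddrow_pow_elemsym; last by lia.
have -> : (n - b + p == n.-1)%N = (p.+1 == b)%N by lia.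
by case: eqP => [<-|]; rewrite ?mulr0.
Qed.

End Annihilation.

(** * Removal of a part *)

Section Parts.
Variable n : nat.
Implicit Types (lambda : {set 'I_n}) (o : 'I_n).

Lemma size_parts lambda : len lambda = #|lambda|.
Proof. by rewrite /len /parts size_rev size_map -cardE. Qed.

Lemma mem_parts lambda o : (o.+1 \in parts lambda) = (o \in lambda).
Proof.
rewrite /parts mem_rev (mem_map (f := fun i : 'I_n => (val i).+1)) ?mem_enum //.
by move=> i j [] /val_inj.
Qed.

Lemma parts_bounds lambda p : p \in parts lambda -> (0 < p <= n)%N.
Proof. by rewrite /parts mem_rev => /mapP[o _ ->]; rewrite /= ltn_ord. Qed.

Lemma val_enum lambda : [seq val i | i <- enum lambda] =
  [seq i <- iota 0 n | i \in [seq val i | i <- enum lambda]].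
Proof.
have vi : injective (@nat_of_ord n) := val_inj.
rewrite -val_enum_ord filter_map /= {1}/enum_mem -enumT; congr map.
by apply: eq_filter => i /=; rewrite (mem_map vi) mem_enum.
Qed.

Lemma sorted_parts lambda : sorted gtn (parts lambda).
Proof.
rewrite /parts rev_sorted map_comp val_enum sorted_map.
by apply: sorted_filter; [move=> a b c /= ab bc; lia | apply: iota_ltn_sorted].
Qed.

Lemma uniq_parts lambda : uniq (parts lambda).
Proof.
by apply: (@sorted_uniq _ gtn) (sorted_parts _) => [a b c /= *|a /=]; lia.
Qed.

Lemma index_sorted (s : seq nat) p : sorted gtn s -> p \in s ->
  index p s = count (fun q => p < q)%N s.
Proof.
elim: s => //= a s IH sa; rewrite inE; case: eqVneq => [->|pa] /= ps.
  rewrite ltnn add0n; symmetry; apply/eqP; rewrite -leqn0 leqNgt -has_count.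
  apply/hasPn=> q qs; have /allP/(_ q qs) := order_path_min (rev_trans ltn_trans) sa.
  by rewrite /=; lia.
have /allP/(_ p ps) /= ap := order_path_min (rev_trans ltn_trans) sa.
by rewrite ap IH // (path_sorted sa).
Qed.

(** For [o] in [lambda] this is the position of the part [o.+1]. *)
Definition larger o lambda : nat := #|[set a in lambda | (o < a)%N]|.

Lemma index_parts lambda o : o \in lambda -> index o.+1 (parts lambda) = larger o lambda.
Proof.
move=> ol; rewrite index_sorted ?sorted_parts ?mem_parts //.
rewrite /parts count_rev count_map /larger cardE -size_filter.
congr size; rewrite /enum_mem -filter_predI; apply: eq_filter => a.
by rewrite /= !inE andbC.
Qed.

Lemma parts_setD1 lambda o : o \in lambda ->
  parts (lambda :\ o) =
    take (larger o lambda) (parts lambda) ++ drop (larger o lambda).+1 (parts lambda).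
Proof.
move=> ol; rewrite -index_parts // -remE rem_filter ?uniq_parts //.
rewrite /parts filter_rev filter_map; congr (rev (map _ _)).
rewrite /enum_mem -filter_predI; apply: eq_filter => a.
by rewrite /= !inE eqSS.
Qed.

Lemma len_setD1 lambda o : o \in lambda -> len lambda = (len (lambda :\ o)).+1.
Proof. by move=> ol; rewrite !size_parts (cardsD1 o) ol. Qed.

Lemma larger_lt lambda o : o \in lambda -> (larger o lambda < len lambda)%N.
Proof. by move=> ol; rewrite -index_parts // index_mem mem_parts. Qed.

(** The parts, with a zero part added to make their number even. *)
Definition padded lambda : seq nat := parts lambda ++ nseq (odd (len lambda)) 0%N.

Lemma size_padded lambda : size (padded lambda) = (uphalf (len lambda)).*2.
Proof. by rewrite /padded size_cat size_nseq -/(len lambda); lia. Qed.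

Lemma Qtilde_pfseq (A : comUnitRingType) (v : seq A) lambda :
  Qtilde lambda v = pfseq (Qtilde2 v) (uphalf (len lambda)) (padded lambda).
Proof.
rewrite -(pfaffian_pfseq (Qtilde2 v) 0%N (size_padded lambda)) /Qtilde.
congr pfaffian; apply/matrixP=> i j; rewrite !mxE /part /= /padded.
have E k : nth 0%N (parts lambda ++ nseq (odd (len lambda)) 0%N) k = nth 0%N (parts lambda) k.
  rewrite nth_cat; case: ltnP => // h; rewrite [RHS]nth_default //.
  by rewrite nth_nseq; case: ifP.
by rewrite !E.
Qed.

End Parts.

Section NablaPtilde.
Variables (R : idomainType) (n : nat) (D : ddsystem R n).
Local Notation x := (dds_x D 0).
Local Notation sa := (dds_s D).
Hypothesis n_gt0 : (0 < n)%N.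
Local Notation X := (vars D).
Implicit Types (lambda : {set 'I_n}) (o : 'I_n) (c f g : R).

Lemma nabla_is_additive : {morph nabla D : f g / f + g}.
Proof. by move=> f g; rewrite /nabla ddD raddfD mulrDr. Qed.

Lemma nablaZ c f : (forall i, sa i c = c) -> nabla D (c * f) = c * nabla D f.
Proof. by move=> ci; rewrite /nabla dd_invl // ddrow_invl // mulrCA. Qed.

Lemma Qtilde2_0 p : Qtilde2 X p 0 = elemsym X p%:Z.
Proof. by rewrite /Qtilde2 big_geq // mulr0 addr0 elemsym0 mulr1. Qed.

(** As [Qtilde2 X p 0] is [elemsym X p], contracting with [elemsym X] is expanding
    along the column of a zero part. *)
Lemma contract_Qtilde lambda (m : nat) : len lambda = m.*2.+1 ->
  contract (fun p => elemsym X p%:Z) (pfseq (Qtilde2 X) m) (parts lambda) = Qtilde lambda X.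
Proof.
move=> lm; rewrite Qtilde_pfseq /padded lm (_ : uphalf _ = m.+1); last by lia.
rewrite /= odd_double /= cats1.
rewrite pfseq_rcons -?lm //; apply: eq_contract => // p.
by rewrite Qtilde2_0.
Qed.

(** The terms that keep the zero part add up to a double contraction with
    [elemsym X], which vanishes. *)
Lemma contract_Qtilde0 lambda (m : nat) : len lambda = m.*2 ->
  contract (fun p => elemsym X p%:Z) (pfseq (Qtilde2 X) m) (rcons (parts lambda) 0%N) =
  Qtilde lambda X.
Proof.
move=> lm; rewrite Qtilde_pfseq /padded lm uphalf_double odd_double cats0.
rewrite contract_rcons -/(len lambda) lm -signr_odd odd_double expr0 elemsym0 !mul1r.
case: m lm => [|m] lm.
  by move: lm; rewrite /len; case: (parts lambda) => //= _; rewrite add0r.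
rewrite (eq_contract (b := fun p => elemsym X p%:Z)
  (G := contract (fun p => elemsym X p%:Z) (pfseq (Qtilde2 X) m))) //.
  by rewrite contract_sq add0r.
move=> u; rewrite -/(len lambda) lm => -[zu].
by rewrite pfseq_rcons //; apply: eq_contract => // p; rewrite Qtilde2_0.
Qed.

(** Of the two contractions in [nabla_pfseq] the first removes the part [o.+1], and
    the second one restores a Pfaffian, as an expansion along a zero part. *)
Lemma nabla_Qtilde lambda o :
  nabla D (x ^+ (n - o.+1) * Qtilde lambda X) =
  if o \in lambda then 2%:R * ((-1) ^+ larger o lambda * Qtilde (lambda :\ o) X) else 0.
Proof.
have oN := ltn_ord o.
have [l0|l0] := posnP (len lambda).
  rewrite ifN; last by apply/negP=> /larger_lt; rewrite l0.
  rewrite Qtilde_pfseq /padded l0 cats0 (size0nil (s := parts lambda)) //.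
  rewrite -[pfseq _ _ _]/(1 : R) mulr1 /nabla dd0_pow ?mulr0 //.
  by move: n_gt0; lia.
have [m lm] : exists m, uphalf (len lambda) = m.+1.
  by exists (uphalf (len lambda)).-1; rewrite prednK //; lia.
have sz := size_padded lambda; rewrite lm in sz.
rewrite Qtilde_pfseq lm (nabla_pfseq D n_gt0 _ sz) //.
have nthp i : (i < len lambda)%N -> nth 0%N (padded lambda) i = nth 0%N (parts lambda) i.
  by move=> il; rewrite /padded nth_cat -/(len lambda) il.
have nth0 i : (len lambda <= i)%N -> nth 0%N (padded lambda) i = 0%N.
  by move=> il; rewrite /padded nth_cat -/(len lambda) ltnNge il /= nth_nseq if_same.
case: ifP => ol; last first.
  rewrite (contract_eq0 _ (z := 0%N)) ?mulr0 // => i ip.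
  have [il|il] := ltnP i (len lambda); last by rewrite nth0.
  rewrite nthp // (_ : _ == _ = false) //; apply/negP => /eqP E.
  by rewrite -mem_parts -E mem_nth in ol.
have k_lt := larger_lt ol; set k := larger o lambda in k_lt *.
have nthk : nth 0%N (parts lambda) k = o.+1.
  by rewrite /k -index_parts // nth_index // mem_parts.
have kp : (k < size (padded lambda))%N.
  by rewrite /padded size_cat -/(len lambda); lia.
rewrite (contract_nth _ (z := 0%N) kp); last first.
  move=> i ip ik; have [il|il] := ltnP i (len lambda); last by rewrite nth0.
  rewrite nthp // -nthk nth_uniq ?uniq_parts // ?(negbTE ik) //.
rewrite nthp // nthk eqxx mul1r; congr (_ * (_ * _)).
rewrite /padded take_cat drop_cat -/(len lambda) k_lt.
have lD := len_setD1 ol.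
case: ifP => kl.
  rewrite catA -parts_setD1 //.
  case ol' : (odd (len lambda)) => /=.
    by rewrite cats1 contract_Qtilde0 //; lia.
  by rewrite cats0 contract_Qtilde //; lia.
have kE : k.+1 = len lambda by lia.
have pE : parts (lambda :\ o) = take k (parts lambda).
  by rewrite parts_setD1 // -/k kE /len drop_size cats0.
rewrite -pE kE subnn drop0.
case ol' : (odd (len lambda)) => /=.
  by rewrite cats1 contract_Qtilde0 //; lia.
by rewrite cats0 contract_Qtilde //; lia.
Qed.

Hypothesis unit2 : (2%:R : R) \is a GRing.unit.

Lemma sa_pow2 i m : sa i (2%:R ^- m) = 2%:R ^- m.
Proof. by rewrite rmorphV ?unitrX // rmorphXn rmorph_nat. Qed.

Lemma nabla_Ptilde lambda o :
  nabla D (x ^+ (n - o.+1) * Ptilde lambda X) =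
  if o \in lambda then (-1) ^+ larger o lambda * Ptilde (lambda :\ o) X else 0.
Proof.
rewrite /Ptilde mulrCA nablaZ; last by move=> i; apply: sa_pow2.
rewrite nabla_Qtilde; case: ifP => ol; last by rewrite mulr0.
rewrite (len_setD1 ol) exprSr invrM ?unitrX //.
rewrite -mulrA [_ * (2%:R * _)]mulrCA mulKr //.
exact: mulrCA.
Qed.

Lemma sa_Ptilde i lambda : (0 < i < n)%N -> sa i (Ptilde lambda X) = Ptilde lambda X.
Proof. by move=> iN; rewrite /Ptilde rmorphM sa_pow2 Qtilde_pfseq sa_pfseq. Qed.

End NablaPtilde.

(** * Insertion of parts in the coefficients *)

Lemma big_setU1_reindex (A : nmodType) (T : finType) (b : T) (P : pred {set T})
    (g : {set T} -> A) :
  \sum_(beta : {set T} | (b \in beta) && P beta) g beta =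
  \sum_(beta : {set T} | (b \notin beta) && P (b |: beta)) g (b |: beta).
Proof.
rewrite (reindex_onto (fun beta => b |: beta) (fun beta => beta :\ b)) /=; last first.
  by move=> beta /andP[bb _]; rewrite setD1K.
apply: eq_bigl => beta; rewrite setU11 /=.
case: (boolP (b \in beta)) => bb /=; last by rewrite setU1K ?eqxx ?andbT.
rewrite (_ : (_ :\ b == beta) = false) ?andbF //.
by apply/negbTE/eqP => E; rewrite -E !inE eqxx in bb.
Qed.

Lemma larger_setU1 n (b : 'I_n) (alpha : {set 'I_n}) :
  larger b (b |: alpha) = larger b alpha.
Proof.
apply: eq_card => a; rewrite !inE; case: eqVneq => // ->.
by rewrite ltnn !andbF.
Qed.

Section CoefficientAction.
Variables (R : idomainType) (n : nat) (D : ddsystem R n).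
Local Notation x := (dds_x D 0).
Local Notation sa := (dds_s D).
Hypothesis n_gt0 : (0 < n)%N.
Hypothesis unit2 : (2%:R : R) \is a GRing.unit.
Local Notation X := (vars D).
Variable y : nat -> R.
Hypothesis y_inv : forall i j, sa i (y j) = y j.
Implicit Types (alpha beta nu : {set 'I_n}) (F : {set 'I_n} -> R) (r b : nat).

(** The coefficient of [x ^+ (n - b.+1)] in [phi y (n - r.+1) x]; it vanishes for
    [b < r]. *)
Definition kappa r b : R :=
  (-1) ^+ (b + r) * elemsym (mkseq y (n - r.+1)) (b%:Z - r%:Z).

Lemma kappa_inv i r b : sa i (kappa r b) = kappa r b.
Proof.
rewrite /kappa rmorphM rmorphXn rmorphN1 rmorph_elemsym -map_comp.
by congr (_ * elemsym _ _); apply: eq_map => j /=.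
Qed.

Lemma phi_kappa r : (r < n)%N ->
  phi y (n - r.+1) x = \sum_(b < n) kappa r b * x ^+ (n - b.+1).
Proof.
move=> rn; rewrite /phi prod_elemsym.
have -> : \sum_(b < n) kappa r b * x ^+ (n - b.+1) =
    \sum_(0 <= b < n) kappa r b * x ^+ (n - b.+1) by rewrite big_mkord.
rewrite (big_cat_nat _ (n := r)) ?(ltnW rn) //=.
rewrite [X in _ = X + _]big_nat_cond [X in _ = X + _]big1 ?add0r; last first.
  move=> b; rewrite ?andbT /= => br; rewrite /kappa elemsym_lt0 ?mulr0 ?mul0r //; lia.
rewrite -[X in \sum_(X <= i < n) _]add0n big_addn big_mkord.
have -> : (n - r = (n - r.+1).+1)%N by lia.
apply: eq_bigr => k _; rewrite /kappa.
have -> : (k + r)%N%:Z - r%:Z = k%:Z by lia.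
have -> : (n - (k + r).+1 = n - r.+1 - k)%N by lia.
rewrite -signr_odd -[in RHS]signr_odd; congr ((-1) ^+ _ * _ * _); lia.
Qed.

Definition Psi F : R := \sum_nu F nu * Ptilde nu X.

(** The transpose of the removal of a part, which is the action of the operators
    [nabla] on coefficients. *)
Definition insert (c : nat -> R) F alpha : R :=
  \sum_(b : 'I_n | b \notin alpha) c b * (-1) ^+ larger b alpha * F (b |: alpha).

Lemma nabla_Psi r F : (r < n)%N -> (forall i nu, sa i (F nu) = F nu) ->
  nabla D (phi y (n - r).-1 x * Psi F) = Psi (insert (kappa r) F).
Proof.
move=> rn Fi; rewrite -subnS phi_kappa // mulr_suml.
have nabla_sum := big_morph (nabla D) (nabla_is_additive D).
have nabla0 : nabla D 0 = 0.
  by apply: (addIr (nabla D 0)); rewrite -nabla_is_additive !add0r.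
rewrite (nabla_sum _ _ nabla0).
transitivity (\sum_(b < n) \sum_(nu : {set 'I_n} | b \in nu)
    kappa r b * F nu * ((-1) ^+ larger b nu * Ptilde (nu :\ b) X)).
  apply: eq_bigr => b _; rewrite /Psi mulr_sumr (nabla_sum _ _ nabla0) [RHS]big_mkcond.
  apply: eq_bigr => nu _.
  rewrite [kappa r b * _ * _](_ : _ = (kappa r b * F nu) * (x ^+ (n - b.+1) * Ptilde nu X)).
    rewrite nablaZ; last by move=> i; rewrite rmorphM kappa_inv Fi.
    by rewrite nabla_Ptilde //; case: ifP; rewrite ?mulr0.
  by ring.
transitivity (\sum_(b < n) \sum_(alpha : {set 'I_n} | b \notin alpha)
    kappa r b * (-1) ^+ larger b alpha * F (b |: alpha) * Ptilde alpha X).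
  apply: eq_bigr => b _; have := big_setU1_reindex b xpredT (fun nu =>
    kappa r b * F nu * ((-1) ^+ larger b nu * Ptilde (nu :\ b) X)).
  under eq_bigl do rewrite andbT; move=> ->.
  apply: eq_big => [nu|nu]; rewrite andbT // => bnu.
  by rewrite larger_setU1 setU1K //; ring.
rewrite (exchange_big_dep xpredT) //=; apply: eq_bigr => alpha _.
by rewrite /insert mulr_suml.
Qed.

Lemma Psi_sym F i : (0 < i < n)%N -> (forall nu, sa i (F nu) = F nu) ->
  sa i (Psi F) = Psi F.
Proof.
move=> iN Fi; rewrite rmorph_sum; apply: eq_bigr => nu _.
by rewrite rmorphM Fi sa_Ptilde.
Qed.

Lemma insert_inv r F i : (forall nu, sa i (F nu) = F nu) ->
  forall nu, sa i (insert (kappa r) F nu) = insert (kappa r) F nu.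
Proof.
move=> Fi nu; rewrite rmorph_sum; apply: eq_bigr => b _.
by rewrite 2!rmorphM kappa_inv Fi rmorphXn rmorphN1.
Qed.

Variables (p : pred nat) (F0 : {set 'I_n} -> R).
Hypothesis F0_inv : forall i nu, sa i (F0 nu) = F0 nu.

(** The values are processed in increasing order, so that the largest unbarred
    one is inserted last. *)
Definition coef_path r : {set 'I_n} -> R :=
  foldr (fun r => insert (kappa r)) F0 (rev [seq i <- iota 0 r | ~~ p i]).

Lemma coef_pathS r :
  coef_path r.+1 = if p r then coef_path r else insert (kappa r) (coef_path r).
Proof.
have iE : iota 0 r.+1 = iota 0 r ++ [:: r] by rewrite -addn1 iotaD.
rewrite /coef_path iE filter_cat rev_cat /=.
by case: (p r).
Qed.

Lemma coef_path_inv r i nu : sa i (coef_path r nu) = coef_path r nu.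
Proof.
rewrite /coef_path; elim: (rev _) nu => [|q s IH] nu /=; first exact: F0_inv.
exact: insert_inv.
Qed.

Lemma reach_Psi : reach D (stair D y 0 n * Psi F0) (path_state n p n)
  ((\prod_(i < n | p i) (-1) ^+ (n - i).-1) * Psi (coef_path n)).
Proof.
have := @reach_path R n D (stair D y 0 n * Psi F0) y p (fun r => Psi (coef_path r)) y_inv.
move=> H; have {}H := H _ _ (erefl _) n (leqnn n).
rewrite subnn mul1r in H; apply: H => [r i iN|r rn].
  by apply: Psi_sym => // nu; apply: coef_path_inv.
rewrite coef_pathS; case: (p r) => //.
by rewrite nabla_Psi // => i nu; apply: coef_path_inv.
Qed.

End CoefficientAction.

(** * Insertions and determinants *)

Section InsertionDeterminant.
Variables (R : idomainType) (n : nat) (c : nat -> nat -> R) (F0 : {set 'I_n} -> R).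
Implicit Types (alpha beta : {set 'I_n}) (b : 'I_n) (r : nat) (rs : seq nat).

(** For disjoint [alpha] and [beta] this is the statistic [excess2]. *)
Definition crossings alpha beta : nat := \sum_(b in beta) larger b alpha.

Definition coef_mx rs beta : 'M[R]_(size rs) :=
  \matrix_(i, j) c (nth 0%N rs j) (nth 0%N (parts beta) i).-1.

Lemma crossings_setU1r alpha beta b : b \notin beta ->
  crossings alpha (b |: beta) = (larger b alpha + crossings alpha beta)%N.
Proof. by move=> bb; rewrite /crossings big_setU1. Qed.

Lemma larger_setU1_notin b b' alpha : b \notin alpha ->
  larger b' (b |: alpha) = ((b' < b) + larger b' alpha)%N.
Proof.
move=> ba; rewrite /larger.
have [lt|ge] := ltnP b' b.
  rewrite (_ : [set a in b |: alpha | (b' < a)%N] = b |: [set a in alpha | (b' < a)%N]).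
    by rewrite cardsU1 !inE (negbTE ba).
  by apply/setP=> a; rewrite !inE; case: eqVneq => // ->; rewrite lt.
apply: eq_card => a; rewrite !inE; case: eqVneq => // ->.
by rewrite (negbTE ba) ltnNge ge.
Qed.

Lemma crossings_setU1l alpha beta b : b \notin alpha -> b \notin beta ->
  (crossings (b |: alpha) beta + larger b beta = crossings alpha beta + len beta)%N.
Proof.
move=> ba bb; rewrite /crossings.
under eq_bigr => b' _ do rewrite larger_setU1_notin //.
rewrite big_split /= -addnA addnCA; congr (_ + _)%N.
rewrite (eq_bigr (fun a : 'I_n => if (a < b)%N then 1%N else 0%N)); last first.
  by move=> a _; case: ltnP.
rewrite -big_mkcondr /= size_parts /larger -sum1_card -[in RHS]sum1_card.
rewrite [in RHS](bigID (fun a : 'I_n => (a < b)%N)) /=; congr (_ + _)%N.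
apply: eq_bigl => a; rewrite !inE -leqNgt; case: (boolP (a \in beta)) => //= ab.
rewrite ltn_neqAle; case: eqVneq => // E.
have {}E : a = b by apply: val_inj.
by rewrite E (negbTE bb) in ab.
Qed.

(** Expansion along the first column; the part [b.+1] labels the row of index
    [larger b beta]. *)
Lemma det_coef_mx r rs beta : len beta = (size rs).+1 ->
  \det (coef_mx (r :: rs) beta) =
  \sum_(b in beta) (-1) ^+ larger b beta * (c r b * \det (coef_mx rs (beta :\ b))).
Proof.
move=> lb; rewrite (expand_det_col _ ord0).
have [b0 b0b] : exists b0, b0 \in beta.
  by apply/card_gt0P; rewrite -size_parts lb.
pose ps := rev (enum beta).
have zps : size ps = (size rs).+1 by rewrite size_rev -cardE -size_parts.
have partsE : parts beta = [seq (val b).+1 | b <- ps] by rewrite /parts -map_rev.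
have ups : uniq ps by rewrite rev_uniq enum_uniq.
have nth_p i : (i < (size rs).+1)%N -> nth 0%N (parts beta) i = (nth b0 ps i).+1.
  by move=> il; rewrite partsE (nth_map b0) ?zps.
have mem_p i : (i < (size rs).+1)%N -> nth b0 ps i \in beta.
  by move=> il; rewrite -mem_enum -mem_rev mem_nth // zps.
have lar i : (i < (size rs).+1)%N -> larger (nth b0 ps i) beta = i.
  move=> il; rewrite -index_parts ?mem_p // -nth_p // index_uniq ?uniq_parts //.
  by rewrite -/(len beta) lb.
transitivity (\sum_(b <- ps) (-1) ^+ larger b beta * (c r b * \det (coef_mx rs (beta :\ b)))).
  rewrite (big_nth b0) zps big_mkord; apply: eq_bigr => i _.
  rewrite lar // !mxE /= nth_p //= /cofactor addn0 mulrCA; congr (_ * (_ * \det _)).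
  apply/matrixP=> i' j; rewrite !mxE /= parts_setD1 ?mem_p // lar // nth_del //.
  by rewrite -/(len beta) lb.
by rewrite (perm_big (enum beta)) ?perm_rev // big_enum.
Qed.

(** Insertions anticommute, so that a sequence of insertions depends on its
    weights through the maximal minors.  The induction is the expansion of the
    determinant along its first column. *)
Lemma foldr_insert rs alpha :
  foldr (fun r => insert (c r)) F0 rs alpha =
  (-1) ^+ 'C(size rs, 2) *
  \sum_(beta : {set 'I_n} | (len beta == size rs) && (alpha :&: beta == set0))
    (-1) ^+ crossings alpha beta * F0 (alpha :|: beta) * \det (coef_mx rs beta).
Proof.
elim: rs alpha => [|r rs IH] alpha.
  rewrite /= mul1r (big_pred1 set0) => [|beta]; last first.
    rewrite size_parts cards_eq0 /=; case: (beta =P set0) => [->|] //=.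
    by rewrite setI0 eqxx.
  by rewrite det_mx00 /crossings big_set0 setU0 expr0 mul1r mulr1.
rewrite [LHS]/= /insert.
transitivity (\sum_(b : 'I_n) \sum_(beta : {set 'I_n} | (b \in beta) &&
     ((len beta == (size rs).+1) && (alpha :&: beta == set0)))
   (-1) ^+ 'C((size rs).+1, 2) * ((-1) ^+ crossings alpha beta * F0 (alpha :|: beta) *
   ((-1) ^+ larger b beta * (c r b * \det (coef_mx rs (beta :\ b)))))); last first.
  rewrite mulr_sumr (exchange_big_dep (fun beta =>
    (len beta == (size rs).+1) && (alpha :&: beta == set0))) /=; last first.
    by move=> b beta _ /andP[].
  apply: eq_bigr => beta /andP[/eqP lb ab].
  rewrite det_coef_mx // !mulr_sumr.
  by apply: eq_bigl => b; rewrite lb ab eqxx !andbT.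
rewrite big_mkcond; apply: eq_bigr => b _; rewrite big_setU1_reindex.
case: (boolP (b \in alpha)) => ba /=.
  rewrite big_pred0 // => beta; apply/negbTE; rewrite !negb_and; apply/orP; right.
  apply/orP; right; apply/eqP => /setP/(_ b).
  by rewrite !inE eqxx ba.
rewrite IH !mulr_sumr; apply: eq_big => [beta|beta].
  rewrite setIUl setU_eq0 setIUr setU_eq0 andbCA.
  have -> : ([set b] :&: beta == set0) = (b \notin beta).
    by rewrite setI_eq0 disjoints1.
  have -> : (alpha :&: [set b] == set0).
    by rewrite setIC setI_eq0 disjoints1.
  case: (boolP (b \in beta)) => //= bb; congr (_ && _).
  by rewrite !size_parts cardsU1 bb add1n eqSS.
rewrite setIUl setU_eq0 => /andP[/eqP lb /andP[]].
rewrite setI_eq0 disjoints1 => bb _.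
rewrite setU1K // larger_setU1 crossings_setU1r // setUCA setUA.
have := crossings_setU1l ba bb; rewrite lb => E.
rewrite binS bin1.
set cab := crossings alpha beta in E *; set cU := crossings (b |: alpha) beta in E *.
transitivity ((-1) ^+ (larger b alpha + 'C(size rs, 2) + cU) *
   (c r b * (F0 (b |: alpha :|: beta) * \det (coef_mx rs beta)))).
  by rewrite !exprD; ring.
transitivity ((-1) ^+ ('C(size rs, 2) + size rs + (larger b alpha + cab) + larger b beta) *
   (c r b * (F0 (b |: alpha :|: beta) * \det (coef_mx rs beta)))); last first.
  by rewrite !exprD; ring.
congr (_ * _); rewrite -signr_odd -[in RHS]signr_odd; congr ((-1) ^+ _).
lia.
Qed.

End InsertionDeterminant.

(** * Statistics on strict partitions and determinants *)

Section PartitionStatistics.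
Variable n : nat.
Implicit Types (lambda mu alpha beta : {set 'I_n}).

Lemma ltn_nth_sorted (s : seq nat) q j : sorted gtn s ->
  (q < nth 0 s j)%N = (j < count (fun a => q < a) s)%N.
Proof.
elim: s j => [|a s IH] j sa; first by rewrite nth_nil.
have /allP lt_a := order_path_min (rev_trans ltn_trans) sa.
have {}IH := IH _ (path_sorted sa).
have [qa|aq] := ltnP q a.
  by case: j => [|j] /=; rewrite qa //= IH add1n ltnS.
have -> : count (fun a => q < a)%N (a :: s) = 0%N.
  apply/eqP; rewrite -leqn0 leqNgt -has_count /= ltnNge aq /=.
  by apply/hasPn=> b /lt_a /=; lia.
rewrite ltn0; case: j => [|j] /=; first by rewrite ltnNge aq.
apply/negbTE; rewrite -leqNgt; have [js|js] := ltnP j (size s).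
  by have := lt_a _ (mem_nth 0%N js); rewrite /=; lia.
by rewrite nth_default.
Qed.

Lemma part_nonincr lambda i j : (i <= j)%N -> (part lambda j.+1 <= part lambda i.+1)%N.
Proof.
move=> ij; rewrite leqNgt /part /=; apply/negP=> lt.
have s := sorted_parts lambda.
have : (nth 0 (parts lambda) i < nth 0 (parts lambda) i)%N; last by rewrite ltnn.
rewrite ltn_nth_sorted //; apply: leq_ltn_trans ij _.
by rewrite -ltn_nth_sorted.
Qed.

Lemma part_bounds lambda i : (i < len lambda)%N -> (0 < part lambda i.+1 <= n)%N.
Proof. by move=> il; apply/parts_bounds/mem_nth. Qed.

Lemma part_default lambda i : (len lambda <= i)%N -> part lambda i.+1 = 0%N.
Proof. exact: nth_default. Qed.

Lemma larger_count lambda (b : 'I_n) :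
  larger b lambda = count (fun a => b.+1 < a)%N (parts lambda).
Proof.
rewrite /parts count_rev count_map /larger cardE -size_filter.
congr size; rewrite /enum_mem -filter_predI; apply: eq_filter => a.
by rewrite /= !inE andbC.
Qed.

(** A part of [beta] exceeded by exactly [i] parts of [alpha] lies in the gap of
    index [i] of [alpha]. *)
Lemma excess2_crossings alpha beta : alpha :&: beta = set0 ->
  excess2 alpha beta = crossings alpha beta.
Proof.
move=> ab; rewrite /excess2 /crossings /interlace.
have countE i : count (fun b => part alpha i.+1 < b < part alpha i)%N (parts beta) =
    (\sum_(b in beta) (part alpha i.+1 < b.+1 < part alpha i)%N)%N.
  by rewrite /parts count_rev count_map -sum1_count big_mkcond big_enum /=;
     apply: eq_bigr => b _; case: ifP.
under eq_bigr => i _ do rewrite countE big_distrr.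
rewrite exchange_big /=; apply: eq_bigr => b bb.
have sp := sorted_parts alpha; rewrite larger_count.
set k := count _ _.
have kE j : (b.+1 < part alpha j.+1)%N = (j < k)%N by apply: ltn_nth_sorted.
have k_le : (k <= len alpha)%N by apply: count_size.
have neq j : part alpha j.+1 != b.+1.
  apply/eqP => E; have [jl|jl] := ltnP j (len alpha); last by rewrite part_default in E.
  have : b.+1 \in parts alpha by rewrite -E; apply: mem_nth.
  by rewrite mem_parts => ba; move/setP/(_ b): ab; rewrite !inE ba bb.
have lt_part j : (part alpha j.+1 < b.+1)%N = (k <= j)%N.
  by rewrite [RHS]leqNgt -kE; have := neq j; lia.
have [k0|k0] := posnP k.
  rewrite k0 big_nat_cond big1 // => -[|i] //= _.
  by rewrite kE k0 ltn0 andbF muln0.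
rewrite (bigD1_seq k) ?iota_uniq ?mem_index_iota //=; last by rewrite k0 ltnS.
have -> : (part alpha k.+1 < b.+1 < part alpha k)%N.
  by rewrite lt_part leqnn -{1}(prednK k0) kE prednK /=.
rewrite muln1 big_nat_cond big1 ?addn0 //.
move=> [|i] //= /andP[_ ik]; rewrite lt_part kE.
by rewrite (_ : _ && _ = false) ?muln0 //; lia.
Qed.

Lemma weight_sum lambda : weight lambda = (\sum_(a in lambda) a.+1)%N.
Proof. by rewrite /weight /parts sumn_rev sumnE big_map big_enum. Qed.

Lemma weight_nth lambda : weight lambda = (\sum_(i < len lambda) part lambda i.+1)%N.
Proof. by rewrite /weight sumnE (big_nth 0%N) big_mkord. Qed.

(** The subtraction in [excess] is not truncated. *)
Lemma weight_ge lambda : ('C((len lambda).+1, 2) <= weight lambda)%N.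
Proof.
rewrite /weight /len; have : all (leq 1) (parts lambda).
  by apply/allP=> a /parts_bounds/andP[].
elim: (parts lambda) (sorted_parts lambda) => //= a s IH sa /andP[a1 s1].
have {}IH := IH (path_sorted sa) s1; rewrite binS bin1.
suff : (size s <= a.-1)%N by lia.
rewrite -(size_iota 1 a.-1); apply: uniq_leq_size.
  by apply: (@sorted_uniq _ gtn) (path_sorted sa) => [x y z /= *|x /=]; lia.
have /allP lt_a := order_path_min (rev_trans ltn_trans) sa.
move=> b bs; rewrite mem_iota; have /= := lt_a b bs; have := allP s1 b bs; lia.
Qed.

Lemma len_compl lambda : (len lambda + len (compl lambda) = n)%N.
Proof. by rewrite !size_parts cardsC card_ord. Qed.

Lemma bin2D a b : ('C(a + b, 2) = 'C(a, 2) + 'C(b, 2) + a * b)%N.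
Proof.
elim: a => [|a IH]; first by rewrite mul0n addn0.
by rewrite addSn !binS !bin1 IH mulSn; lia.
Qed.

(** The three summands come from the sign in the definition of [dSchubertB], from
    the barred values moved along the path, and from the order of the insertions. *)
Lemma sign_parity lambda :
  odd ((n * n.-1)./2 + (\sum_(a in lambda) (n - a).-1)%N + 'C(len (compl lambda), 2)) =
  odd (excess lambda).
Proof.
have wE : ((\sum_(a in lambda) (n - a).-1)%N + weight lambda = n * len lambda)%N.
  rewrite weight_sum -big_split /= size_parts mulnC -sum_nat_const.
  by apply: eq_bigr => a _; have := ltn_ord a; lia.
have := weight_ge lambda; have nE := len_compl lambda.
rewrite -bin2 /excess -[(len lambda).+1]/(len lambda).+1.
have -> : ((len lambda * (len lambda).+1)./2 = 'C((len lambda).+1, 2))%N.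
  by rewrite bin2 mulnC.
have bn : 'C(n, 2) = ('C(len lambda, 2) + 'C(len (compl lambda), 2)
    + len lambda * len (compl lambda))%N by rewrite -bin2D nE.
have mn : (n * len lambda = len lambda * len lambda + len lambda * len (compl lambda))%N.
  by rewrite -mulnDr nE mulnC.
have : (len lambda * len lambda = len lambda + 'C(len lambda, 2).*2)%N.
  by elim: (len lambda) => // l IH; rewrite binS bin1; lia.
move: wE; rewrite mn bn binS bin1.
set S := (\sum_(a in lambda) _)%N; set l := len lambda; set k := len _.
set w := weight _; set kl := (l * k)%N; set ll := (l * l)%N.
set ck := 'C(k, 2); set cl := 'C(l, 2); lia.
Qed.

End PartitionStatistics.

(** By the pigeonhole principle every permutation meets the block. *)
Lemma det_zero_block (A : comNzRingType) k (M : 'M[A]_k) (r : 'I_k) :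
  (forall i j : 'I_k, (r <= i)%N -> (j <= r)%N -> M i j = 0) -> \det M = 0.
Proof.
move=> M0; rewrite /determinant big1 // => s _.
have [i /andP[ri ir]|none] := pickP (fun i : 'I_k => (r <= i)%N && (s i <= r)%N).
  by rewrite (bigD1 i) //= M0 // mul0r mulr0.
have sub : s @: [set i : 'I_k | (r <= i)%N] \subset [set i : 'I_k | (r < i)%N].
  apply/subsetP=> _ /imsetP[i + ->]; rewrite !inE => ri.
  by have := none i; rewrite ri /= leqNgt => /negbFE.
have := subset_leq_card sub; rewrite card_imset; last exact: perm_inj.
rewrite (cardsD1 r) inE leqnn add1n ltnNge => /negP[].
apply: subset_leq_card; apply/subsetP=> i; rewrite !inE => ri.
by rewrite -val_eqE /= gtn_eqF // ltnW.
Qed.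

Lemma det_scale (A : comNzRingType) k (M : 'M[A]_k) (a b : 'I_k -> A) :
  \det (\matrix_(i, j) (a i * M i j * b j)) = (\prod_i a i) * \det M * \prod_j b j.
Proof.
have -> : \matrix_(i, j) (a i * M i j * b j) =
    diag_mx (\row_i a i) *m M *m diag_mx (\row_j b j).
  by apply/matrixP=> i j; rewrite mul_mx_diag mul_diag_mx !mxE.
rewrite !det_mulmx !det_diag.
by congr (_ * _ * _); apply: eq_bigr => i _; rewrite mxE.
Qed.

(** * Signs and coefficients *)

Section Grassmannian.
Variable n : nat.
Implicit Types (lambda mu alpha beta : {set 'I_n}).

Definition in_parts lambda : pred nat := mem [seq val a | a <- enum lambda].

Lemma in_partsE lambda (a : 'I_n) : in_parts lambda a = (a \in lambda).
Proof. by rewrite /in_parts /= (mem_map val_inj) mem_enum. Qed.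

Lemma filter_in_parts lambda :
  [seq i <- iota 0 n | in_parts lambda i] = [seq val a | a <- enum lambda].
Proof. by rewrite [RHS]val_enum. Qed.

Lemma filter_notin_parts lambda :
  [seq i <- iota 0 n | ~~ in_parts lambda i] = [seq val a | a <- enum (compl lambda)].
Proof.
rewrite -filter_in_parts; apply: eq_in_filter => i; rewrite mem_iota => /andP[_ iN].
by rewrite -[i]/(val (Ordinal iN)) !in_partsE inE.
Qed.

Lemma path_state_part_perm lambda :
  path_state n (in_parts lambda) n = oneline (part_perm lambda).
Proof.
rewrite /path_state subnn /= /path_tail filter_in_parts filter_notin_parts -map_rev.
have pE : part_perm_seq lambda = rev (enum lambda) ++ enum (compl lambda) by [].
apply: (@eq_from_nth _ 0).
  rewrite size_oneline size_cat !size_map size_rev -!cardE -!size_parts.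
  exact: len_compl.
move=> k; rewrite -!map_comp size_cat !size_map size_rev -!cardE -!size_parts len_compl => kn.
pose o := Ordinal kn; rewrite -[k]/(val o) nth_oneline /= ffunE permE.
rewrite nth_cat size_map size_rev -cardE -size_parts pE nth_cat size_rev -cardE -size_parts.
case: ltnP => kl.
  rewrite (nth_map o) ?size_rev -?cardE -?size_parts //=.
  by rewrite expr1 mulN1r.
have kl' : (k - len lambda < len (compl lambda))%N by have := len_compl lambda; lia.
by rewrite (nth_map o) -?cardE -?size_parts //= mul1r.
Qed.

End Grassmannian.

Section Coefficients.
Variables (R : idomainType) (n : nat).
Variables (y : nat -> R) (F0 : {set 'I_n} -> R) (lambda : {set 'I_n}).
Local Notation mu := (compl lambda).
Local Notation k := (len mu).
Implicit Types (alpha beta : {set 'I_n}).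

Definition elem_mx beta : 'M[R]_k :=
  \matrix_(i < k, j < k) elemsym (mkseq y (n - part mu j.+1))
    ((part beta i.+1)%:Z - (part mu j.+1)%:Z).

(** The signs of the coefficients [kappa] factor out of the rows and columns. *)
Lemma det_kappa beta (rs := rev [seq val a | a <- enum mu]) : len beta = k ->
  \det (coef_mx (kappa n y) rs beta) =
  (-1) ^+ (weight beta + weight mu) * \det (elem_mx beta).
Proof.
move=> lb; have zrs : size rs = k by rewrite size_rev size_map -cardE -size_parts.
have partsE : parts mu = [seq i.+1 | i <- rs] by rewrite /parts map_rev -map_comp.
have dE : \det (coef_mx (kappa n y) rs beta) = \det (\matrix_(i < k, j < k)
    kappa n y (nth 0%N rs j) (nth 0%N (parts beta) i).-1).
  by rewrite -zrs.
rewrite dE.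
have -> : (\matrix_(i < k, j < k) kappa n y (nth 0%N rs j) (nth 0%N (parts beta) i).-1) =
  \matrix_(i < k, j < k) ((-1) ^+ part beta i.+1 * elem_mx beta i j * (-1) ^+ part mu j.+1).
  apply/matrixP=> i j; rewrite !mxE /kappa.
  have -> : part mu j.+1 = (nth 0%N rs j).+1.
    by rewrite /part partsE (nth_map 0%N) ?zrs /=.
  have /part_bounds/andP[] : (i < len beta)%N by rewrite lb.
  rewrite /part /=; case: (nth 0%N (parts beta) i) => // b _ _.
  have -> : b.+1%:Z - (nth 0%N rs j).+1%:Z = b%:Z - (nth 0%N rs j)%:Z by lia.
  rewrite [RHS]mulrAC -exprD addSn addnS /= exprS mulN1r exprS mulN1r opprK.
  by [].
by rewrite det_scale !weight_nth lb exprD -!prodrXr; ring.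
Qed.

Lemma coef_pathE alpha :
  coef_path y (in_parts lambda) F0 n alpha =
  (-1) ^+ 'C(k, 2) * \sum_(beta : {set 'I_n} |
      (len beta == k) && (alpha :&: beta == set0))
    (-1) ^+ crossings alpha beta * F0 (alpha :|: beta) *
    ((-1) ^+ (weight beta + weight mu) * \det (elem_mx beta)).
Proof.
rewrite /coef_path filter_notin_parts foldr_insert.
have zrs : size (rev [seq val a | a <- enum mu]) = k.
  by rewrite size_rev size_map -cardE -size_parts.
congr ((-1) ^+ 'C(_, 2) * _); first exact: zrs.
apply: eq_big => [beta|beta /andP[/eqP lb _]]; first by rewrite zrs.
by rewrite det_kappa // lb zrs.
Qed.

(** If the diagram of [mu] is not contained in the one of [beta], the
    elementary symmetric polynomials of negative degree form a block of zeros
    that meets the diagonal. *)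
Lemma det_not_contained beta : len beta = k -> ~~ contained mu beta ->
  \det (elem_mx beta) = 0.
Proof.
move=> lb; rewrite negb_forall => /existsP[r]; rewrite -ltnNge => lt.
have rk : (r < k)%N.
  by rewrite ltnNge; apply/negP => kr; rewrite (part_default kr) in lt.
apply: (@det_zero_block _ _ _ (Ordinal rk)) => i j /= ri jr.
rewrite mxE elemsym_lt0 //.
by have := part_nonincr beta ri; have := part_nonincr mu jr; lia.
Qed.

Lemma sign_path : \prod_(i < n | in_parts lambda i) (-1) ^+ (n - i).-1 =
  (-1) ^+ (\sum_(a in lambda) (n - a).-1)%N :> R.
Proof. by rewrite prodrXr; congr (_ ^+ _); apply: eq_bigl => a; rewrite in_partsE. Qed.

Lemma collect_signs (P : {set 'I_n} -> R) :
  (-1) ^+ (n * n.-1)./2 * (\prod_(i < n | in_parts lambda i) (-1) ^+ (n - i).-1 *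
    \sum_alpha coef_path y (in_parts lambda) F0 n alpha * P alpha) =
  (-1) ^+ (excess lambda + weight mu) * \sum_alpha P alpha *
    \sum_(beta | [&& contained mu beta, len beta == k & alpha :&: beta == set0])
      (-1) ^+ (excess2 alpha beta + weight beta) * F0 (alpha :|: beta) *
      \det (elem_mx beta).
Proof.
rewrite sign_path !mulr_sumr; apply: eq_bigr => alpha _; rewrite coef_pathE.
rewrite mulr_sumr !mulr_suml !mulr_sumr [RHS]big_mkcond [LHS]big_mkcond.
apply: eq_bigr => beta _.
have [lb|_] := eqVneq (len beta) k; last by rewrite /= andbF.
have [ab|_] := eqVneq (alpha :&: beta) set0; last by rewrite /= andbF.
have [cb|cb] := boolP (contained mu beta); last first.
  by rewrite det_not_contained // ?mulr0 ?mul0r ?mulr0.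
rewrite /= excess2_crossings //.
set S := (\sum_(a in lambda) _)%N; set cr := crossings _ _.
set d := \det _; set f := F0 _; set wb := weight beta; set wm := weight mu.
transitivity ((-1) ^+ ((n * n.-1)./2 + S + 'C(k, 2) + cr + wb + wm) * (P alpha * (f * d))).
  by rewrite !exprD; ring.
transitivity ((-1) ^+ (excess lambda + cr + wb + wm) * (P alpha * (f * d))).
  congr (_ * _); rewrite -signr_odd -[RHS]signr_odd; congr ((-1) ^+ _).
  by rewrite !oddD -sign_parity !oddD.
by rewrite !exprD; ring.
Qed.

End Coefficients.

(** * The formula *)

Section DoubleSchubertGrassmannian.
Variables (K : idomainType) (n : nat).
Hypothesis n_gt0 : (0 < n)%N.
Hypothesis unit2 : (2%:R : K) \is a GRing.unit.
Variable Y : seq K.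
Hypothesis sizeY : (n <= size Y)%N.
Local Notation R := {mpoly K[n]}.
Local Notation D := (mpoly_ddsystem K n).
Implicit Types (lambda alpha beta : {set 'I_n}).

Let y (j : nat) : R := (Y`_j)%:MP.
Let F0 (nu : {set 'I_n}) : R := (Ptilde (compl nu) Y)%:MP.

Lemma vars_Xvars : vars D = Xvars K n.
Proof.
have zX : size (Xvars K n) = n by rewrite size_map size_enum_ord.
by rewrite /vars -[RHS](mkseq_nth 0) zX.
Qed.

Lemma staircase_prod (S : idomainType) (E : ddsystem S n) (z : nat -> S) k m :
  stair E z k m = \prod_(i < m) phi z (m.-1 - i) (dds_x E (k + i)).
Proof.
elim: m k => [|m IH] k; first by rewrite big_ord0.
rewrite big_ord_recl /= subn0 addn0 IH; congr (_ * _).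
apply: eq_bigr => i _; rewrite /bump /= addSnnS; congr phi.
by case: m {IH} i => [[]//|m] i; rewrite add1n.
Qed.

Lemma Delta_stair : Delta n Y = stair D y 0 n.
Proof.
rewrite staircase_prod /Delta; apply: eq_bigr => i _.
have le : (n.-1 - i <= n)%N by lia.
rewrite /phi (big_ord_widen _ (fun j => dds_x D (0 + i) - y j) le).
apply: eq_big => [j|j _]; first by have := ltn_ord i; lia.
by rewrite add0n -[dds_x D i]/(xvar K n i) xvar_ord.
Qed.

Lemma PtildeXY_Psi : PtildeXY n Y = Psi D F0.
Proof. by rewrite /PtildeXY /Psi vars_Xvars; apply: eq_bigr => nu _; rewrite mulrC. Qed.

Lemma unit2_mpoly : (2%:R : R) \is a GRing.unit.
Proof. by have := rmorph_unit (@mpolyC n K) unit2; rewrite rmorph_nat. Qed.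

Lemma det_elem_mx lambda beta :
  \det (elem_mx y lambda beta) =
  (\det (\matrix_(i < len (compl lambda), j < len (compl lambda))
     elemsym (take (n - part (compl lambda) j.+1) Y)
       ((part beta i.+1)%:Z - (part (compl lambda) j.+1)%:Z)))%:MP.
Proof.
rewrite -det_map_mx; congr (\det _); apply/matrixP=> i j; rewrite !mxE.
rewrite rmorph_elemsym; congr elemsym.
have le : (n - part (compl lambda) j.+1 <= size Y)%N by lia.
by rewrite -(mkseq_nth 0 Y) -map_take take_iota (minn_idPl le) -map_comp.
Qed.

Theorem dSchubertB_Grassmannian lambda :
  dSchubertB Y (part_perm lambda) =
  (-1) ^+ (excess lambda + weight (compl lambda)) *
  \sum_alpha Ptilde alpha (Xvars K n) *
    (\sum_(beta | [&& contained (compl lambda) beta,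
                      len beta == len (compl lambda) & alpha :&: beta == set0])
       (-1) ^+ (excess2 alpha beta + weight beta) *
       Ptilde (compl (alpha :|: beta)) Y *
       \det (\matrix_(i < len (compl lambda), j < len (compl lambda))
               elemsym (take (n - part (compl lambda) j.+1) Y)
                 ((part beta i.+1)%:Z - (part (compl lambda) j.+1)%:Z)))%:MP.
Proof.
have y_inv i j : dds_s D i (y j) = y j  by apply: sactC.
have F0_inv i nu : dds_s D i (F0 nu) = F0 nu  by apply: sactC.
have [w [lw sw zw fw]] := reach_Psi n_gt0 unit2_mpoly y_inv (in_parts lambda) F0_inv.
rewrite path_state_part_perm in sw zw.
rewrite /dSchubertB (ddiff'_permE _ lw sw zw) Delta_stair PtildeXY_Psi fw.
rewrite /Psi vars_Xvars collect_signs; congr (_ * _).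
apply: eq_bigr => alpha _; congr (_ * _); rewrite rmorph_sum; apply: eq_bigr => beta _.
by rewrite 2!rmorphM rmorphXn rmorphN1 det_elem_mx.
Qed.

End DoubleSchubertGrassmannian.

Lemma Zhalf_unit2 : (2%:R : Zhalf) \is a GRing.unit.
Proof.
have half : (2%:R^-1 : rat) \in dyadic by apply/dyadicP; exists 1%N, 1; rewrite expr1 mulVf.
apply/unitrPr; exists (MkZhalf half); apply: val_inj.
by rewrite rmorphM rmorph1 rmorph_nat /= mulfV.
Qed.

Theorem theorem4 (n : nat) (hn : (1 <= n)%N) (lambda : strict_partition n) :
  dSchubertB (Yvars n) (part_perm lambda) =
  (-1) ^+ (excess lambda + weight (compl lambda)) *
  \sum_(alpha : strict_partition n)
    Ptilde alpha (Xvars {mpoly Zhalf[n]} n) *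
    (\sum_(beta : strict_partition n |
           [&& contained (compl lambda) beta,
               len beta == len (compl lambda)
             & alpha :&: beta == set0])
       (-1) ^+ (excess2 alpha beta + weight beta) *
       Ptilde (compl (alpha :|: beta)) (Yvars n) *
       \det (\matrix_(i < len (compl lambda), j < len (compl lambda))
               elemsym (take (n - part (compl lambda) j.+1) (Yvars n))
                 ((part beta i.+1)%:Z - (part (compl lambda) j.+1)%:Z)))%:MP.
Proof.
apply: dSchubertB_Grassmannian => //; last by rewrite size_map size_enum_ord.
exact: unit2_mpoly Zhalf_unit2.
Qed.
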